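(* Let $m,p\in\mathbb{N}$ with $p\ge2$. Suppose that $f=h+\overline{g}$ is harmonic in $\mathbb{D}$, where $h(z)=\sum_{k=0}^{\infty}a_{pk+m}z^{pk+m}$ and $g(z)=\sum_{k=0}^{\infty}b_{pk+m}z^{pk+m}$ are analytic and bounded in $\mathbb{D}$. Put $B_H(f,r)=\sum_{k=0}^{\infty}(|a_{pk+m}|+|b_{pk+m}|)r^{pk+m}$. Then the following hold. (1) If $\frac pm>\log_23$, then $B_H(f,r)\le\max\{\|h\|_\infty,\|g\|_\infty\}$ for $0\le r\le\sqrt[m]{1/2}$. The function $f(z)=z^m+\overline{\lambda z^m}$, $|\lambda|=1$, is extremal. (2) If $1\le\frac pm\le\log_23$, then $B_H(f,r)\le\max\{\|h\|_\infty,\|g\|_\infty\}$ for $0\le r\le r_{p,m}$, where $r_{p,m}$ is the maximal positive root in $(0,1)$ of the equation $$-12r^{p-m}+r^{2(p-m)}+32r^{2p}+4=0.$$ The function $f(z)=h(z)+\overline{\lambda h(z)}$, $|\lambda|=1$, is extremal, where $$h(z)=z^m\left(\frac{z^p-a}{1-az^p}\right)\quad\text{with}\quad a=\left(1-\frac{\sqrt{1-r_{p,m}^{2p}}}{\sqrt2}\right)\frac1{r_{p,m}^p}.$$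
   Context: $\mathbb{D}=\{z\in\mathbb{C}:|z|<1\}$, $\mathbb N=\{1,2,\dots\}$, and $\|h\|_\infty=\sup_{z\in\mathbb{D}}|h(z)|$. ''Extremal'' means that the stated radius is attained and cannot be enlarged because of this $f$: $B_H(f,r)=\max\{\|h\|_\infty,\|g\|_\infty\}$ when $r$ equals the stated radius, and $B_H(f,r)>\max\{\|h\|_\infty,\|g\|_\infty\}$ for larger $r\in(0,1)$. *)

(* Defs.v *)
From Stdlib Require Import Reals.
From Coquelicot Require Import Coquelicot.
Open Scope R_scope.

Definition in_disc (z : C) : Prop := Cmod z < 1.

(** [sup_norm] takes values in [R] and is only used for functions that are
    bounded on the disc, where the least upper bound is finite. *)
Definition bounded_on_disc (h : C -> C) : Prop :=
  exists M : R, forall z : C, in_disc z -> Cmod (h z) <= M.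

Definition sup_norm (h : C -> C) : R :=
  real (Lub_Rbar (fun x : R => exists z : C, in_disc z /\ x = Cmod (h z))).

Definition analytic_on_disc (h : C -> C) : Prop :=
  forall z : C, in_disc z -> ex_derive (K := C_AbsRing) (V := C_NormedModule) h z.

(** [ex_diff_n u 2] at every point of the open disc says that [u] is of class
    C^2 there. *)
Definition real_harmonic_on_disc (u : R -> R -> R) : Prop :=
  forall x y : R, in_disc (x, y) ->
    ex_diff_n u 2 x y /\
    partial_derive 2 0 u x y + partial_derive 0 2 u x y = 0.

Definition harmonic_on_disc (f : C -> C) : Prop :=
  real_harmonic_on_disc (fun x y => Re (f (x, y))) /\
  real_harmonic_on_disc (fun x y => Im (f (x, y))).

(** Only the coefficients [a n] with [n = p * k + m] are meaningful; the other
    values of [a] are ignored here and in [B_H]. *)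
Definition lacunary_expansion (p m : nat) (a : nat -> C) (h : C -> C) : Prop :=
  forall z : C, in_disc z ->
    is_series (K := C_AbsRing) (V := C_NormedModule)
      (fun k : nat => (a (p * k + m)%nat * z ^ (p * k + m))%C) (h z).

Record harmonic_class (p m : nat) (f h g : C -> C) (a b : nat -> C) : Prop := {
  hc_harmonic : harmonic_on_disc f;
  hc_decomposition : forall z : C, in_disc z -> f z = (h z + Cconj (g z))%C;
  hc_analytic_h : analytic_on_disc h;
  hc_analytic_g : analytic_on_disc g;
  hc_expansion_h : lacunary_expansion p m a h;
  hc_expansion_g : lacunary_expansion p m b g;
  hc_bounded_h : bounded_on_disc h;
  hc_bounded_g : bounded_on_disc g
}.

(** The coefficient sequences are determined, at the indices used, by
    [h] and [g], hence (as [m >= 1] forces [h 0 = g 0 = 0]) by [f].  The series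
    converges for [0 <= r < 1] as soon as the expansions hold on the disc, so
    the default value of [Series] plays no role. *)
Definition B_H (p m : nat) (a b : nat -> C) (r : R) : R :=
  Series (fun k : nat =>
    (Cmod (a (p * k + m)%nat) + Cmod (b (p * k + m)%nat)) * r ^ (p * k + m)).

Definition max_norm (h g : C -> C) : R := Rmax (sup_norm h) (sup_norm g).

Definition bohr_inequality_up_to (p m : nat) (R0 : R) : Prop :=
  forall (f h g : C -> C) (a b : nat -> C),
    harmonic_class p m f h g a b ->
    forall r : R, 0 <= r <= R0 -> B_H p m a b r <= max_norm h g.

Definition extremal (p m : nat) (R0 : R) (f h g : C -> C) : Prop :=
  exists a b : nat -> C,
    harmonic_class p m f h g a b /\
    B_H p m a b R0 = max_norm h g /\
    forall r : R, R0 < r < 1 -> B_H p m a b r > max_norm h g.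

Definition log2 (x : R) : R := ln x / ln 2.

Definition radius_equation (p m : nat) (r : R) : Prop :=
  - 12 * r ^ (p - m) + r ^ (2 * (p - m)) + 32 * r ^ (2 * p) + 4 = 0.

Definition is_maximal_root (p m : nat) (r : R) : Prop :=
  (0 < r < 1 /\ radius_equation p m r) /\
  forall s : R, 0 < s < 1 -> radius_equation p m s -> s <= r.

Definition extremal_parameter (p : nat) (r : R) : R :=
  (1 - sqrt (1 - r ^ (2 * p)) / sqrt 2) * (1 / r ^ p).

Definition extremal_h (p m : nat) (a : R) (z : C) : C :=
  (z ^ m * ((z ^ p - RtoC a) / (1 - RtoC a * z ^ p)))%C.

(* Main.v *)
(** A bounded [h] with [h z = sum a_(p k + m) z^(p k + m)] satisfies [h z = z^m phi (z^p)].  Parseval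
    for [(1 + tau z^n) phi], with the best [tau], turns [|phi| <= 1] into
    [(1 - |c_0|^2) sum_(0<k<n) |c_k|^2 + |c_n|^2 <= (1 - |c_0|^2)^2] for the coefficients [c_k]
    of [phi].  Abel summation and Cauchy-Schwarz then bound [sum |c_k| rho^k] by
    [K a rho := a + rho (1 - a^2) / (1 - a rho)], [a = |c_0|], when [rho <= a], and by [1] when
    [a < rho <= 1/2].  So each of [h] and [g] contributes at most half of its norm as long as
    [r^m K a (r^p) <= 1/2] for all [a].  For [r^p <= 1/3] the maximum of [K] over [a] is [1]; for
    [r^p >= 1/3] it is attained at the extremal parameter, and the condition becomes a sign
    condition on the radius equation. *)

Require Import Defs.
From Stdlib Require Import Reals Arith Lra Lia Classical FunctionalExtensionality.
From Coquelicot Require Import Coquelicot.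
Open Scope R_scope.

(** * Discrete Parseval identity *)

(** The threshold log_2 3 tells which of two obstructions comes first as [r] grows: [a = 1] requires
    [r^m <= 1/2], while [K] exceeds [1] for some [a < 1] as soon as [r^p > 1/3]; the two radii
    coincide when [3^m = 2^p]. Allotting half of its norm to each of [h] and [g] loses nothing,
    since the extremal [g] is a unimodular multiple of [h]. The constants of the radius equation
    come from [u = 1 - a rho]: with [x = r^(p - m)] the condition reads
    [6 - x <= 4 u + 2 (1 - rho^2) / u], and the arithmetic-geometric mean inequality yields it from
    [(6 - x)^2 <= 32 (1 - rho^2)]. Parseval is applied to polynomials averaged over roots of unity,
    so the partial sums must be bounded on the whole circle; working at radius [s < 1] gives the
    absolute convergence that bounds them. Harmonicity of the extremal functions asks for real C^2
    regularity, obtained from a class of repeatedly complex differentiable functions closed under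
    the operations that build them. *)

Notation Csum := (@sum_n C_AbelianMonoid).
Notation Rsum := (@sum_n R_AbelianMonoid).

(* Sums live in the carrier of a canonical structure, which [ring] does not see through. *)
Ltac Cring := match goal with |- @eq _ ?a ?b => change (@eq C a b); ring end.
Ltac Rring := match goal with |- @eq _ ?a ?b => change (@eq R a b); ring end.

Definition cis (t : R) : C := (cos t, sin t).

Lemma cis_plus (s t : R) : cis (s + t) = (cis s * cis t)%C.
Proof.
  apply injective_projections; simpl; [apply cos_plus | rewrite sin_plus; ring].
Qed.

Lemma cis_0 : cis 0 = RtoC 1.
Proof. unfold cis, RtoC. now rewrite cos_0, sin_0. Qed.

Lemma cis_pow (t : R) (n : nat) : (cis t ^ n)%C = cis (INR n * t).
Proof.
  induction n as [|n IH].
  - simpl. rewrite Rmult_0_l, cis_0. reflexivity.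
  - rewrite Cpow_S, IH, <- cis_plus. f_equal. rewrite S_INR. ring.
Qed.

Lemma Cmod_cis (t : R) : Cmod (cis t) = 1.
Proof.
  unfold Cmod, cis. simpl.
  replace (cos t * (cos t * 1) + sin t * (sin t * 1)) with 1.
  apply sqrt_1. generalize (sin2_cos2 t). unfold Rsqr. lra.
Qed.

Lemma Cconj_cis (t : R) : Cconj (cis t) = cis (- t).
Proof. unfold cis, Cconj. simpl. now rewrite cos_neg, sin_neg. Qed.

(** Halving the angle: [cos t = 1 - 2 sin^2(t / 2)], and [|t| / 2] lies where the sine is
    positive. *)
Lemma cis_ne_1 (t : R) : 0 < Rabs t < 2 * PI -> cis t <> RtoC 1.
Proof.
  intros [H1 H2] E. unfold cis, RtoC in E. injection E as E _.
  assert (E' : cos (Rabs t) = 1).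
  { unfold Rabs; destruct (Rcase_abs t); [rewrite cos_neg|]; exact E. }
  replace (Rabs t) with (2 * (Rabs t / 2)) in E' by field.
  rewrite cos_2a_sin in E'.
  assert (0 < sin (Rabs t / 2)) by (apply sin_gt_0; lra).
  nra.
Qed.

Lemma cis_INR_2PI (k : nat) : cis (INR k * (2 * PI)) = RtoC 1.
Proof.
  unfold cis, RtoC. rewrite <- (Rplus_0_l (INR k * (2 * PI))).
  replace (0 + INR k * (2 * PI)) with (0 + 2 * INR k * PI) by ring.
  now rewrite cos_period, sin_period, cos_0, sin_0.
Qed.

Lemma Csum_geom (q : C) (n : nat) :
  (Csum (fun j => q ^ j) n * (1 - q))%C = (1 - q ^ S n)%C.
Proof.
  induction n as [|n IH].
  - rewrite sum_O. simpl. ring.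
  - rewrite sum_Sn. change (@plus C_AbelianMonoid) with Cplus.
    rewrite Cmult_plus_distr_r, IH, !Cpow_S. ring.
Qed.

Lemma Csum_mult_l (a : C) (u : nat -> C) (n : nat) :
  Csum (fun k => a * u k)%C n = (a * Csum u n)%C.
Proof. exact (sum_n_mult_l (K := C_Ring) a u n). Qed.

Lemma Csum_mult_r (a : C) (u : nat -> C) (n : nat) :
  Csum (fun k => u k * a)%C n = (Csum u n * a)%C.
Proof. exact (sum_n_mult_r (K := C_Ring) a u n). Qed.

Lemma Cconj_sum (u : nat -> C) (n : nat) :
  Cconj (Csum u n) = Csum (fun k => Cconj (u k)) n.
Proof.
  induction n as [|n IH]; [now rewrite !sum_O|].
  rewrite !sum_Sn, <- IH. apply Cplus_conj.
Qed.

Lemma RtoC_sum (u : nat -> R) (n : nat) :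
  RtoC (Rsum u n) = Csum (fun k => RtoC (u k)) n.
Proof.
  induction n as [|n IH]; [now rewrite !sum_O|].
  rewrite !sum_Sn, <- IH. apply RtoC_plus.
Qed.

Lemma sum_n_kronecker (G : AbelianMonoid) (u : nat -> G) (k n : nat) :
  (k <= n)%nat ->
  sum_n (fun l => if Nat.eq_dec k l then u l else zero) n = u k.
Proof.
  assert (Z : forall j, (j < k)%nat ->
    sum_n (fun l => if Nat.eq_dec k l then u l else zero) j = zero).
  { intros j. induction j as [|j IH]; intros Hj.
    - rewrite sum_O. destruct (Nat.eq_dec k 0); [lia|reflexivity].
    - rewrite sum_Sn, IH by lia.
      destruct (Nat.eq_dec k (S j)); [lia|apply plus_zero_l]. }
  induction n as [|n IH]; intros Hk.
  - rewrite sum_O. destruct (Nat.eq_dec k 0); [now subst|lia].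
  - rewrite sum_Sn. destruct (Nat.eq_dec k (S n)) as [->|Hn].
    + rewrite Z by lia. apply plus_zero_l.
    + rewrite IH by lia. apply plus_zero_r.
Qed.

(** The order is [S N] because [sum_n _ N] has [S N] terms; exponents up to [N] are then distinct
    modulo the order. *)
Definition root_angle (N j : nat) : R := INR j * (2 * PI / INR (S N)).

(** The sum is geometric with a ratio [q] satisfying [q ^ S N = 1], and [q <> 1] for [k <> l]
    because [|k - l| < S N]. *)
Lemma root_orthogonality (N k l : nat) : (k <= N)%nat -> (l <= N)%nat ->
  Csum (fun j => cis (root_angle N j) ^ k * Cconj (cis (root_angle N j) ^ l))%C N
  = if Nat.eq_dec k l then RtoC (INR (S N)) else RtoC 0.
Proof.
  intros Hk Hl.
  assert (HN : 0 < INR (S N)) by (apply lt_0_INR; lia).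
  set (q := cis ((INR k - INR l) * (2 * PI / INR (S N)))).
  rewrite (sum_n_ext _ (fun j => q ^ j)%C).
  2:{ intros j. rewrite !cis_pow, Cconj_cis, <- cis_plus. unfold q.
      rewrite cis_pow. f_equal. unfold root_angle. ring. }
  destruct (Nat.eq_dec k l) as [->|Hkl].
  - assert (q = RtoC 1) as ->.
    { unfold q. rewrite <- cis_0. f_equal. ring. }
    rewrite (sum_n_ext _ (fun j => RtoC 1)) by (intros; apply Cpow_1_l).
    rewrite <- RtoC_sum. f_equal. rewrite sum_n_const. apply Rmult_1_r.
  - assert (Hq : q <> RtoC 1).
    { apply cis_ne_1.
      assert (0 < Rabs (INR k - INR l) < INR (S N)).
      { apply le_INR in Hk as Hk'. apply le_INR in Hl as Hl'.
        generalize (pos_INR k) (pos_INR l). intros. rewrite S_INR.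
        split; [apply Rabs_pos_lt; intros E; apply Hkl, INR_eq; lra|].
        unfold Rabs; destruct Rcase_abs; lra. }
      assert (Hp : 0 < 2 * PI / INR (S N)).
      { apply Rdiv_lt_0_compat; [generalize PI_RGT_0; lra|assumption]. }
      rewrite Rabs_mult, (Rabs_pos_eq (2 * PI / _)) by lra.
      split; [apply Rmult_lt_0_compat; tauto|].
      apply Rlt_le_trans with (INR (S N) * (2 * PI / INR (S N))).
      - apply Rmult_lt_compat_r; tauto.
      - right. field. lra. }
    assert (HqN : (q ^ S N)%C = RtoC 1).
    { unfold q. rewrite cis_pow.
      replace (INR (S N) * ((INR k - INR l) * (2 * PI / INR (S N))))
        with (INR k * (2 * PI) + - (INR l * (2 * PI))) by (field; lra).
      rewrite cis_plus, <- Cconj_cis, !cis_INR_2PI.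
      apply injective_projections; simpl; ring. }
    generalize (Csum_geom q N). rewrite HqN.
    replace (RtoC 1 - RtoC 1)%C with (RtoC 0) by ring. intros E.
    destruct (Ceq_dec (1 - q)%C (RtoC 0)) as [E1|E1].
    + exfalso. apply Hq. replace q with (1 - (1 - q))%C by ring. rewrite E1. ring.
    + apply NNPP. intros Hs. now apply (Cmult_neq_0 _ _ Hs E1).
Qed.

Lemma discrete_parseval (A : nat -> C) (N : nat) :
  Rsum (fun j => Cmod (Csum (fun k => A k * cis (root_angle N j) ^ k)%C N) ^ 2) N
  = INR (S N) * Rsum (fun k => Cmod (A k) ^ 2) N.
Proof.
  apply RtoC_inj. rewrite RtoC_sum, RtoC_mult, RtoC_sum.
  transitivity (Csum (fun j => Csum (fun k => Csum (fun l =>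
     (A k * Cconj (A l)) *
       (cis (root_angle N j) ^ k * Cconj (cis (root_angle N j) ^ l)))%C N) N) N).
  { apply sum_n_ext. intros j. rewrite Cmod2_conj, Cconj_sum, <- Csum_mult_r. apply sum_n_ext. intros k.
    rewrite <- Csum_mult_l. apply sum_n_ext. intros l.
    rewrite Cmult_conj. Cring. }
  (* Two exchanges of summation make the sum over the roots innermost, where orthogonality
     applies. *)
  rewrite sum_n_switch, <- Csum_mult_l. apply sum_n_ext_loc. intros k Hk.
  rewrite sum_n_switch.
  rewrite (sum_n_ext_loc _ (fun l => if Nat.eq_dec k l
     then (INR (S N) * (A l * Cconj (A l)))%C else zero)).
  - rewrite sum_n_kronecker by exact Hk. now rewrite Cmod2_conj.
  - intros l Hl. rewrite Csum_mult_l, root_orthogonality by assumption.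
    destruct (Nat.eq_dec k l) as [->|]; [Cring|apply Cmult_0_r].
Qed.

(** * Coefficients of bounded power series *)

Lemma sum_n_trunc (G : AbelianMonoid) (u : nat -> G) (N n : nat) :
  (forall k, (N < k)%nat -> u k = zero) -> sum_n u (N + n) = sum_n u N.
Proof.
  intros Hu. induction n as [|n IH]; [now rewrite Nat.add_0_r|].
  rewrite Nat.add_succ_r, sum_Sn, IH, Hu by lia. apply plus_zero_r.
Qed.

Lemma sum_n_shift (G : AbelianMonoid) (u : nat -> G) (N n : nat) :
  (forall k, (k < n)%nat -> u k = zero) ->
  sum_n u (N + n) = sum_n (fun k => u (k + n)%nat) N.
Proof.
  intros Hu. induction N as [|N IH].
  - rewrite sum_O. simpl. destruct n as [|n]; [apply sum_O|].
    assert (Z : forall j, (j <= n)%nat -> sum_n u j = zero).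
    { induction j as [|j IH]; intros Hj; [rewrite sum_O; apply Hu; lia|].
      rewrite sum_Sn, IH, Hu by lia. apply plus_zero_l. }
    rewrite sum_Sn, Z by lia. apply plus_zero_l.
  - simpl. now rewrite !sum_Sn, IH.
Qed.

Lemma Rsum_le_add (u : nat -> R) (N n : nat) :
  (forall k, 0 <= u k) -> Rsum u N <= Rsum u (N + n).
Proof.
  intros Hu. induction n as [|n IH]; [rewrite Nat.add_0_r; lra|].
  rewrite Nat.add_succ_r, sum_Sn. apply Rle_trans with (1 := IH).
  generalize (Hu (S (N + n))). unfold plus; simpl. lra.
Qed.

Lemma Rsum_le_Series (u : nat -> R) (n : nat) :
  (forall k, 0 <= u k) -> ex_series u -> Rsum u n <= Series u.
Proof.
  intros Hu Hs. apply Series_correct in Hs.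
  apply (is_lim_seq_incr_compare (sum_n u)); [exact Hs|].
  intros k. rewrite sum_Sn. generalize (Hu (S k)). unfold plus; simpl. lra.
Qed.

Lemma Series_le_bound (u : nat -> R) (K : R) :
  ex_series u -> (forall n, Rsum u n <= K) -> Series u <= K.
Proof.
  intros Hs H. apply Series_correct in Hs.
  exact (is_lim_seq_le (Rsum u) (fun _ => K) (Series u) K H Hs (is_lim_seq_const K)).
Qed.

Lemma is_series_Cmod (u : nat -> C) (l : C) (eps : R) : 0 < eps ->
  is_series (K := C_AbsRing) (V := C_NormedModule) u l ->
  exists N, forall n, (N <= n)%nat -> Cmod (Csum u n - l) < eps.
Proof.
  intros He H.
  exact (proj1 (filterlim_locally_ball_norm (K := C_AbsRing) (U := C_NormedModule)
    (sum_n u) l) H (mkposreal eps He)).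
Qed.

(** A bound on [F] does not bound its partial sums; absolute summability does so up to [eps], with
    one [N0] for the whole circle. *)
Lemma uniform_partial_sums (A : nat -> C) (F : R -> C) (M eps : R) :
  ex_series (fun k => Cmod (A k)) ->
  (forall t, is_series (K := C_AbsRing) (V := C_NormedModule)
     (fun k => A k * cis t ^ k)%C (F t)) ->
  (forall t, Cmod (F t) <= M) -> 0 < eps ->
  exists N0, forall N t, (N0 <= N)%nat ->
    Cmod (Csum (fun k => A k * cis t ^ k)%C N) <= M + eps.
Proof.
  intros HA HF HM He.
  assert (Hp : forall k, 0 <= Cmod (A k)) by (intros; apply Cmod_ge_0).
  generalize (Series_correct _ HA). intros HL.
  assert (H : exists N0, forall n, (N0 <= n)%nat ->
     Rabs (Rsum (fun k => Cmod (A k)) n - Series (fun k => Cmod (A k))) < eps / 2).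
  { exact (proj2 (is_lim_seq_spec (Rsum (fun k => Cmod (A k))) (Series (fun k => Cmod (A k)))) HL
      (mkposreal (eps / 2) ltac:(lra))). }
  destruct H as [N0 H0]. exists N0. intros N t HN.
  (* [N1] depends on [t] but only serves to approach [F t]; the block between [N] and [N + N1] is
     below [eps / 2] by the choice of [N0] alone. *)
  destruct (is_series_Cmod _ _ (eps / 2) ltac:(lra) (HF t)) as [N1 H1].
  specialize (H1 (N + N1)%nat ltac:(lia)). specialize (H0 N HN).
  set (u := fun k => (A k * cis t ^ k)%C) in *.
  assert (D : forall n, Cmod (Csum u (N + n) - Csum u N)%C <=
     Rsum (fun k => Cmod (A k)) (N + n) - Rsum (fun k => Cmod (A k)) N).
  { induction n as [|n IH].
    - rewrite Nat.add_0_r.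
      replace (Csum u N - Csum u N)%C with (RtoC 0) by Cring. rewrite Cmod_0. lra.
    - rewrite Nat.add_succ_r, !sum_Sn.
      replace (plus (Csum u (N + n)) (u (S (N + n))) - Csum u N)%C
        with ((Csum u (N + n) - Csum u N) + u (S (N + n)))%C
        by (unfold plus; simpl; Cring).
      eapply Rle_trans; [apply Cmod_triangle|].
      assert (Cmod (u (S (N + n))) = Cmod (A (S (N + n)))) as ->.
      { unfold u. rewrite Cmod_mult, Cmod_pow, Cmod_cis, pow1. apply Rmult_1_r. }
      unfold plus; simpl in *. lra. }
  specialize (D N1).
  generalize (Rsum_le_Series _ (N + N1) Hp HA). intros HS.
  apply Rabs_def2 in H0.
  replace (Csum u N) with (F t + (Csum u (N + N1) - F t) + - (Csum u (N + N1) - Csum u N))%C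
    by Cring.
  eapply Rle_trans; [apply Cmod_triangle|]. rewrite Cmod_opp.
  eapply Rle_trans; [apply Rplus_le_compat_r, Cmod_triangle|].
  specialize (HM t). lra.
Qed.

Lemma le_of_forall_eps_sq (x c : R) :
  (forall eps, 0 < eps -> x <= (1 + eps) ^ 2 * c) -> 0 <= c -> x <= c.
Proof.
  intros H Hc. apply le_epsilon. intros e He.
  (* For [d <= 1] one has [(1 + d)^2 <= 1 + 3 d], so the excess is at most [3 d c <= e]. *)
  set (d := Rmin 1 (e / (3 * (c + 1)))).
  assert (Hq : 0 < e / (3 * (c + 1))) by (apply Rdiv_lt_0_compat; lra).
  assert (0 < d) by (apply Rmin_glb_lt; lra).
  assert (d <= 1) by apply Rmin_l.
  assert (d <= e / (3 * (c + 1))) by apply Rmin_r.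
  assert (d * (3 * (c + 1)) <= e).
  { replace e with (e / (3 * (c + 1)) * (3 * (c + 1))) by (field; lra).
    apply Rmult_le_compat_r; lra. }
  specialize (H d ltac:(lra)). nra.
Qed.

(* Parseval for [(1 + tau z^n) phi(z)], whose modulus on the circle is at most
   that of [1 + tau z^n]. *)
Lemma bounded_coeff_inequality (A : nat -> C) (F : R -> C) (n : nat) (tau : C) :
  ex_series (fun k => Cmod (A k)) ->
  (forall t, is_series (K := C_AbsRing) (V := C_NormedModule)
     (fun k => A k * cis t ^ k)%C (F t)) ->
  (forall t, Cmod (F t) <= 1) ->
  Rsum (fun k => Cmod (A k) ^ 2) n + Cmod (A (S n) + tau * A 0%nat)%C ^ 2
  <= 1 + Cmod tau ^ 2.
Proof.
  intros HA HF HM.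
  apply le_of_forall_eps_sq.
  2:{ generalize (pow2_ge_0 (Cmod tau)); lra. }
  intros eps He.
  destruct (uniform_partial_sums A F 1 eps HA HF HM He) as [N0 HN0].
  set (N := (N0 + S n)%nat).
  specialize (fun t => HN0 N t ltac:(unfold N; lia)).
  set (beta := fun k => if le_lt_dec k N then A k else RtoC 0).
  (* Coefficients of [(1 + tau z^(S n))] times the truncation of the series at [N], a polynomial of
     degree at most [M]. *)
  set (D := fun k => (beta k + if le_lt_dec (S n) k then tau * beta (k - S n)%nat else 0)%C).
  set (M := (N + S n)%nat).
  assert (HD : forall z, Csum (fun k => D k * z ^ k)%C M =
     ((1 + tau * z ^ S n) * Csum (fun k => A k * z ^ k)%C N)%C).
  { intros z.
    rewrite (sum_n_ext _ (fun k => plus (G := C_AbelianMonoid) (beta k * z ^ k)%C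
       ((if le_lt_dec (S n) k then tau * beta (k - S n)%nat else 0) * z ^ k)%C)).
    2:{ intros k. unfold D, plus; simpl. Cring. }
    rewrite sum_n_plus. unfold M. rewrite sum_n_trunc, sum_n_shift.
    - rewrite Cmult_plus_distr_r, Cmult_1_l.
      rewrite (sum_n_ext_loc (fun k => beta k * z ^ k)%C (fun k => A k * z ^ k)%C).
      2:{ intros k Hk. unfold beta. destruct (le_lt_dec k N); [reflexivity|lia]. }
      apply (f_equal2 Cplus); [reflexivity|]. rewrite <- Csum_mult_l.
      apply sum_n_ext_loc. intros k Hk. destruct (le_lt_dec (S n) (k + S n)); [|lia].
      replace (k + S n - S n)%nat with k by lia. unfold beta.
      destruct (le_lt_dec k N); [|lia]. rewrite Cpow_add_r. Cring.
    - intros k Hk. destruct (le_lt_dec (S n) k); [lia|]. apply Cmult_0_l.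
    - intros k Hk. unfold beta. destruct (le_lt_dec k N); [lia|]. apply Cmult_0_l. }
  (* [1 + tau z^(S n)] is also written as a polynomial of degree at most [M], so that both Parseval
     identities average over the same roots. *)
  set (E := fun k => plus (G := C_AbelianMonoid)
     (if Nat.eq_dec 0 k then RtoC 1 else RtoC 0) (if Nat.eq_dec (S n) k then tau else RtoC 0)).
  assert (HE : forall z, Csum (fun k => E k * z ^ k)%C M = (1 + tau * z ^ S n)%C).
  { intros z.
    rewrite (sum_n_ext _ (fun k => plus (G := C_AbelianMonoid)
       (if Nat.eq_dec 0 k then (1 * z ^ k)%C else zero)
       (if Nat.eq_dec (S n) k then (tau * z ^ k)%C else zero))).
    2:{ intros k. unfold E. change (@plus C_AbelianMonoid) with Cplus.
        change (@zero C_AbelianMonoid) with (RtoC 0).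
        destruct (Nat.eq_dec 0 k), (Nat.eq_dec (S n) k); Cring. }
    rewrite sum_n_plus, !sum_n_kronecker by (unfold M, N; lia).
    change (@plus C_AbelianMonoid) with Cplus. Cring. }
  generalize (discrete_parseval D M) (discrete_parseval E M). intros PD PE.
  assert (HES : Rsum (fun k => Cmod (E k) ^ 2) M = 1 + Cmod tau ^ 2).
  { rewrite (sum_n_ext _ (fun k => plus (G := R_AbelianMonoid)
       (if Nat.eq_dec 0 k then 1 else zero)
       (if Nat.eq_dec (S n) k then Cmod tau ^ 2 else zero))).
    - rewrite sum_n_plus.
      rewrite (sum_n_kronecker R_AbelianMonoid (fun _ => 1)) by (unfold M, N; lia).
      rewrite (sum_n_kronecker R_AbelianMonoid (fun _ => Cmod tau ^ 2)) by (unfold M, N; lia).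
      reflexivity.
    - intros k. unfold E. change (@plus C_AbelianMonoid) with Cplus.
      change (@plus R_AbelianMonoid) with Rplus. change (@zero R_AbelianMonoid) with 0.
      destruct (Nat.eq_dec 0 k), (Nat.eq_dec (S n) k); try lia;
      rewrite ?Cplus_0_l, ?Cplus_0_r, ?Cmod_0, ?Cmod_1;
      Rring. }
  rewrite HES in PE.
  assert (HM0 : 0 < INR (S M)) by (apply lt_0_INR; lia).
  (* At each root the truncated series has modulus at most [1 + eps]; the pointwise comparison is
     averaged and turned back into coefficients. *)
  assert (HDS : Rsum (fun k => Cmod (D k) ^ 2) M <= (1 + eps) ^ 2 * (1 + Cmod tau ^ 2)).
  { apply Rmult_le_reg_l with (1 := HM0). rewrite <- PD.
    rewrite <- Rmult_assoc, (Rmult_comm (INR _)), Rmult_assoc, <- PE.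
    rewrite <- (sum_n_mult_l (K := R_Ring)). apply sum_n_m_le. intros j.
    rewrite HD, HE, Cmod_mult, Rpow_mult_distr. unfold mult; simpl (Ring.mult _ _ _).
    unfold mult; simpl. rewrite Rmult_comm.
    apply Rmult_le_compat_r; [apply (pow2_ge_0 (Cmod _))|].
    generalize (HN0 (root_angle M j)) (Cmod_ge_0 (Csum (fun k => A k * cis (root_angle M j) ^ k)%C N)).
    intros. nra. }
  apply Rle_trans with (2 := HDS).
  (* Among the coefficients up to [S n], only the last one feels the factor: [D k = A k] below it,
     and [D (S n) = A (S n) + tau A 0]. *)
  apply Rle_trans with (Rsum (fun k => Cmod (D k) ^ 2) (S n)).
  - rewrite sum_Sn. apply Req_le. unfold plus; simpl (AbelianMonoid.plus _ _ _).
    f_equal.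
    + apply sum_n_ext_loc. intros k Hk. unfold D, beta, N.
      destruct (le_lt_dec k (N0 + S n)); [|lia]. destruct (le_lt_dec (S n) k); [lia|].
      now rewrite Cplus_0_r.
    + unfold D, beta, N.
      destruct (le_lt_dec (S n) (N0 + S n)); [|lia]. destruct (le_lt_dec (S n) (S n)); [|lia].
      rewrite Nat.sub_diag. destruct (le_lt_dec 0 (N0 + S n)); [reflexivity|lia].
  - unfold M. rewrite Nat.add_comm. apply Rsum_le_add. intros; apply pow2_ge_0.
Qed.

(** * Weighted coefficient sums *)

(** Abel summation; the terms of [y] may have any sign, only their partial sums are controlled. *)
Lemma sum_weighted_decreasing (y : nat -> R) (E r : R) (n : nat) :
  0 <= r <= 1 -> (forall j, Rsum y j <= E) -> Rsum (fun k => y k * r ^ k) n <= E.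
Proof.
  intros Hr HY.
  cut (Rsum (fun k => y k * r ^ k) n + r ^ n * (E - Rsum y n) <= E).
  { assert (0 <= r ^ n) by (apply pow_le; tauto). specialize (HY n). nra. }
  induction n as [|n IH].
  - rewrite !sum_O. simpl. lra.
  - rewrite !sum_Sn. change (@plus R_AbelianMonoid) with Rplus. simpl (r ^ S n).
    assert (0 <= r ^ n) by (apply pow_le; tauto). specialize (HY n).
    assert (0 <= r ^ n * (E - Rsum y n)) by (apply Rmult_le_pos; lra).
    nra.
Qed.

Lemma Rsum_geom_le (q : R) (n : nat) :
  0 <= q < 1 -> Rsum (pow q) n <= / (1 - q).
Proof.
  intros Hq. rewrite <- (Series_geom q) by (rewrite Rabs_pos_eq; lra).
  apply (Rsum_le_Series (pow q)); [intros; apply pow_le; lra|].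
  apply ex_series_geom. rewrite Rabs_pos_eq; lra.
Qed.

Lemma Rsum_plus (u v : nat -> R) (n : nat) :
  Rsum (fun k => u k + v k) n = Rsum u n + Rsum v n.
Proof. exact (sum_n_plus (G := R_AbelianMonoid) u v n). Qed.

Lemma Rsum_mult_l (a : R) (u : nat -> R) (n : nat) :
  Rsum (fun k => a * u k) n = a * Rsum u n.
Proof. exact (sum_n_mult_l (K := R_Ring) a u n). Qed.

Lemma Rsum_le (u v : nat -> R) (n : nat) :
  (forall k, u k <= v k) -> Rsum u n <= Rsum v n.
Proof. intros H. now apply sum_n_m_le. Qed.

Lemma Rsum_ext (u v : nat -> R) (n : nat) :
  (forall k, u k = v k) -> Rsum u n = Rsum v n.
Proof. intros H. now apply sum_n_ext. Qed.

Lemma Rsum_S (u : nat -> R) (n : nat) : Rsum u (S n) = Rsum u n + u (S n).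
Proof. exact (sum_Sn (G := R_AbelianMonoid) u n). Qed.

Lemma Rsum_head (u : nat -> R) (n : nat) :
  Rsum u (S n) = u 0%nat + Rsum (fun k => u (S k)) n.
Proof.
  induction n as [|n IH]; [now rewrite Rsum_S, !sum_O|].
  rewrite Rsum_S, IH, Rsum_S. Rring.
Qed.

(** Multiplying the generating series of [w] by [1 - c X] gives coefficients [y] whose partial sums
    are the left sides of the last hypothesis; Abel summation of [y] therefore bounds [(1 - c r)]
    times the weighted sum of [w]. *)
Lemma weighted_square_sum (w : nat -> R) (c E r : R) (n : nat) :
  (forall k, 0 <= w k) -> 0 <= c -> 0 <= r <= 1 -> w 0%nat <= E ->
  (forall j, (1 - c) * Rsum w j + w (S j) <= E) ->
  (1 - c * r) * Rsum (fun k => w k * r ^ k) n <= E.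
Proof.
  intros Hw Hc Hr H0 HS.
  set (y := fun k => match k with O => w O | S j => w (S j) - c * w j end).
  assert (HY : forall j, Rsum y j <= E).
  { intros [|j]; [now rewrite sum_O|].
    rewrite Rsum_head. unfold y.
    replace (Rsum (fun k => w (S k) - c * w k) j)
      with (Rsum (fun k => w (S k)) j + - c * Rsum w j).
    - generalize (Rsum_head w j) (Rsum_S w j) (HS j). lra.
    - rewrite <- Rsum_mult_l, <- Rsum_plus. apply Rsum_ext. intros; simpl; ring. }
  apply Rle_trans with (2 := sum_weighted_decreasing y E r n Hr HY).
  destruct n as [|n].
  - rewrite !sum_O. simpl. specialize (Hw 0%nat).
    assert (0 <= c * r * w 0%nat) by (repeat apply Rmult_le_pos; tauto). lra.
  - rewrite (Rsum_head (fun k => y k * r ^ k)). unfold y.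
    replace (Rsum (fun k => (w (S k) - c * w k) * r ^ S k) n)
      with (Rsum (fun k => w (S k) * r ^ S k) n + - (c * r) * Rsum (fun k => w k * r ^ k) n).
    + rewrite Rmult_minus_distr_r, (Rsum_head (fun k => w k * r ^ k)) at 1.
      (* The shifted sum stops one term earlier than the full one; as [w >= 0], completing it only
         strengthens the bound. *)
      assert (H1 : Rsum (fun k => w k * r ^ k) n <= Rsum (fun k => w k * r ^ k) (S n)).
      { rewrite Rsum_S. assert (0 <= r ^ S n) by (apply pow_le; tauto).
        specialize (Hw (S n)). nra. }
      assert (0 <= c * r) by (apply Rmult_le_pos; tauto).
      assert (c * r * Rsum (fun k => w k * r ^ k) n <= c * r * Rsum (fun k => w k * r ^ k) (S n))
        by now apply Rmult_le_compat_l.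
      lra.
    + rewrite <- Rsum_mult_l, <- Rsum_plus. apply Rsum_ext. intros; simpl; ring.
Qed.

(* The parameter [rho / a] in the weighted square sum is the one for which the
   Cauchy-Schwarz estimate is an equality for Moebius coefficients. *)
Lemma tail_sum_large_head (x : nat -> R) (a rho : R) (n : nat) :
  (forall k, 0 <= x k) -> 0 < rho <= a -> a < 1 -> x 0%nat <= 1 - a ^ 2 ->
  (forall j, (1 - a ^ 2) * Rsum (fun k => x k ^ 2) j + x (S j) ^ 2 <= (1 - a ^ 2) ^ 2) ->
  Rsum (fun k => x k * rho ^ k) n <= (1 - a ^ 2) / (1 - a * rho).
Proof.
  intros Hx Hr Ha H0 HS.
  assert (Har : a * rho < 1) by nra.
  assert (Ha2 : 0 < 1 - a ^ 2) by nra.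
  assert (Hra : 0 <= rho / a <= 1).
  { split; [apply Rlt_le, Rdiv_lt_0_compat; lra|].
    apply Rmult_le_reg_r with a; [lra|]. field_simplify; lra. }
  generalize (weighted_square_sum (fun k => x k ^ 2) (a ^ 2) ((1 - a ^ 2) ^ 2) (rho / a) n
    ltac:(intros; apply pow2_ge_0) ltac:(nra) Hra
    ltac:(apply pow_incr; auto) HS).
  replace (1 - a ^ 2 * (rho / a)) with (1 - a * rho) by (field; lra).
  intros HW.
  generalize (Rsum_geom_le (a * rho) n ltac:(split; nra)). intros HG.
  (* Cauchy-Schwarz in the termwise form [2 u v <= u^2 + v^2], with weights [(rho / a)^k] and
     [(a rho)^k] of geometric mean [rho^k]; equality holds at [x k = (1 - a^2) a^k]. *)
  assert (H2 : Rsum (fun k => 2 * (1 - a ^ 2) * (x k * rho ^ k)) n <=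
    Rsum (fun k => x k ^ 2 * (rho / a) ^ k + (1 - a ^ 2) ^ 2 * (a * rho) ^ k) n).
  { apply Rsum_le. intros k.
    assert (H : 0 < a ^ k) by (apply pow_lt; lra).
    assert (H1 : 0 < rho ^ k) by (apply pow_lt; lra).
    unfold Rdiv. rewrite !Rpow_mult_distr, pow_inv.
    revert H H1. generalize (a ^ k) (rho ^ k). intros q s Hq Hs.
    apply Rminus_le_0.
    match goal with |- 0 <= ?u =>
      replace u with (s * ((x k - (1 - a ^ 2) * q) ^ 2 / q)) by (field; lra) end.
    apply Rmult_le_pos; [lra|]. apply Rdiv_le_0_compat; [apply pow2_ge_0|lra]. }
  rewrite Rsum_plus, !Rsum_mult_l in H2.
  assert (HW' : Rsum (fun k => x k ^ 2 * (rho / a) ^ k) n <= (1 - a ^ 2) ^ 2 / (1 - a * rho)).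
  { apply Rmult_le_reg_l with (1 - a * rho); [lra|].
    replace ((1 - a * rho) * (_ / _)) with ((1 - a ^ 2) ^ 2) by (field; lra). exact HW. }
  assert (HG' : (1 - a ^ 2) ^ 2 * Rsum (pow (a * rho)) n
     <= (1 - a ^ 2) ^ 2 / (1 - a * rho)).
  { apply Rmult_le_compat_l; [apply pow2_ge_0|exact HG]. }
  apply Rmult_le_reg_l with (2 * (1 - a ^ 2)); [lra|].
  replace (2 * (1 - a ^ 2) * ((1 - a ^ 2) / (1 - a * rho)))
    with (2 * ((1 - a ^ 2) ^ 2 / (1 - a * rho))) by (field; lra).
  lra.
Qed.

(** For [a < rho] the weight [rho / a] would exceed [1], so only the plain square sum is used.
    Termwise equality is placed at [x k = (1 - rho^2) rho^k], which makes this bound meet that of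
    [tail_sum_large_head] at [a = rho]. *)
Lemma tail_sum_small_head (x : nat -> R) (a rho : R) (n : nat) :
  0 < rho < 1 -> Rsum (fun k => x k ^ 2) n <= 1 - a ^ 2 ->
  Rsum (fun k => x k * rho ^ k) n <= ((1 - a ^ 2) / (1 - rho ^ 2) + 1) / 2.
Proof.
  intros Hr Hx.
  assert (Hr2 : 0 < 1 - rho ^ 2) by nra.
  generalize (Rsum_geom_le (rho ^ 2) n ltac:(split; nra)). intros HG.
  assert (H2 : Rsum (fun k => 2 * (1 - rho ^ 2) * (x k * rho ^ k)) n <=
    Rsum (fun k => x k ^ 2 + (1 - rho ^ 2) ^ 2 * (rho ^ 2) ^ k) n).
  { apply Rsum_le. intros k. rewrite <- pow_mult, Nat.mul_comm, pow_mult.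
    generalize (pow2_ge_0 (x k - (1 - rho ^ 2) * rho ^ k)). lra. }
  rewrite Rsum_plus, !Rsum_mult_l in H2.
  assert (HG' : (1 - rho ^ 2) ^ 2 * Rsum (pow (rho ^ 2)) n <= 1 - rho ^ 2).
  { apply Rle_trans with ((1 - rho ^ 2) ^ 2 * / (1 - rho ^ 2)); [|right; field; lra].
    apply Rmult_le_compat_l; [apply pow2_ge_0|exact HG]. }
  apply Rmult_le_reg_l with (2 * (1 - rho ^ 2)); [lra|].
  replace (2 * (1 - rho ^ 2) * (((1 - a ^ 2) / (1 - rho ^ 2) + 1) / 2))
    with (1 - a ^ 2 + (1 - rho ^ 2)) by (field; lra).
  lra.
Qed.

(** The [K] of the overview: the sum of the absolute values of the terms at [rho] of the expansion
    of [(w - a) / (1 - a w)]. *)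
Definition moebius_bohr (a rho : R) : R := a + rho * (1 - a ^ 2) / (1 - a * rho).

Lemma bohr_partial_sum_le (x : nat -> R) (rho K : R) (n : nat) :
  (forall k, 0 <= x k) ->
  (forall j, Rsum (fun k => x k ^ 2) j <= 1) ->
  (forall j, (1 - x 0%nat ^ 2) * (Rsum (fun k => x k ^ 2) j - x 0%nat ^ 2) + x (S j) ^ 2
     <= (1 - x 0%nat ^ 2) ^ 2) ->
  0 < rho <= 1 / 2 -> 1 <= K ->
  (forall a, rho <= a <= 1 -> moebius_bohr a rho <= K) ->
  Rsum (fun k => x k * rho ^ k) n <= K.
Proof.
  intros Hx HP HE Hr HK HM.
  set (a := x 0%nat) in *.
  assert (Ha : 0 <= a <= 1).
  { generalize (Hx 0%nat) (HP 0%nat). rewrite sum_O. fold a. split; nra. }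
  apply Rle_trans with (Rsum (fun k => x k * rho ^ k) (S n)).
  { rewrite Rsum_S. generalize (Rmult_le_pos _ _ (Hx (S n)) (pow_le rho (S n) ltac:(lra))). lra. }
  rewrite Rsum_head. fold a.
  replace (Rsum (fun k => x (S k) * rho ^ S k) n)
    with (rho * Rsum (fun k => x (S k) * rho ^ k) n).
  2:{ rewrite <- Rsum_mult_l. apply Rsum_ext. intros; simpl; ring. }
  rewrite Rmult_1_r.
  assert (HP' : forall j, Rsum (fun k => x (S k) ^ 2) j = Rsum (fun k => x k ^ 2) (S j) - a ^ 2).
  { intros j. generalize (Rsum_head (fun k => x k ^ 2) j). fold a. lra. }
  destruct (Rle_lt_dec rho a) as [Hra|Hra].
  - specialize (HM a ltac:(lra)). unfold moebius_bohr in HM.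
    apply Rle_trans with (2 := HM). apply Rplus_le_compat_l.
    unfold Rdiv. rewrite Rmult_assoc. apply Rmult_le_compat_l; [lra|].
    (* The large-head estimate requires [a < 1]; for [a = 1] the coefficient inequality makes all
       later terms vanish. *)
    destruct (Req_dec a 1) as [E|E].
    + rewrite E. rewrite (Rsum_ext _ (fun k => 0 * 0)).
      * rewrite (Rsum_mult_l 0 (fun _ => 0)). right. rewrite pow1. ring.
      * intros k. specialize (HE k). rewrite E, pow1 in HE.
        assert (x (S k) = 0) as -> by (specialize (Hx (S k)); nra). simpl. ring.
    + apply (tail_sum_large_head (fun k => x (S k)) a rho n); [auto|lra|lra| |].
      * specialize (HE 0%nat). rewrite sum_O in HE. cbv beta in HE. fold a in HE.
        specialize (Hx 1%nat). assert (0 < 1 - a ^ 2) by nra. nra.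
      * intros j. rewrite HP'. apply HE.
  - apply Rle_trans with (2 := HK).
    generalize (tail_sum_small_head (fun k => x (S k)) a rho n ltac:(lra)
       ltac:(rewrite HP'; specialize (HP (S n)); lra)).
    set (T := Rsum _ _). intros HT.
    apply Rle_trans with (a + rho * (((1 - a ^ 2) / (1 - rho ^ 2) + 1) / 2)).
    { apply Rplus_le_compat_l, Rmult_le_compat_l; lra. }
    assert (Hr2 : 0 < 1 - rho ^ 2) by nra.
    apply Rmult_le_reg_l with (2 * (1 - rho ^ 2)); [lra|].
    replace (_ * (_ + _)) with (2 * a * (1 - rho ^ 2) + rho * (1 - a ^ 2 + (1 - rho ^ 2)))
      by (field; lra).
    (* The gap to the bound [1] is this product plus twice the next one; both are nonnegative
       because [a < rho <= 1/2]. *)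
    assert (0 <= (rho - a) * (2 * (1 - rho ^ 2) - rho * (rho + a))) by (apply Rmult_le_pos; nra).
    assert (0 <= (1 - rho ^ 2) * (1 - 2 * rho)) by (apply Rmult_le_pos; nra).
    nra.
Qed.

Lemma schwarz_coeff_inequality (A : nat -> C) (n : nat) :
  (forall tau, Rsum (fun k => Cmod (A k) ^ 2) n + Cmod (A (S n) + tau * A 0%nat)%C ^ 2
     <= 1 + Cmod tau ^ 2) ->
  (1 - Cmod (A 0%nat) ^ 2) * (Rsum (fun k => Cmod (A k) ^ 2) n - Cmod (A 0%nat) ^ 2)
    + Cmod (A (S n)) ^ 2 <= (1 - Cmod (A 0%nat) ^ 2) ^ 2.
Proof.
  intros H.
  generalize (Cmod_ge_0 (A 0%nat)) (Cmod_ge_0 (A (S n))). intros Ha Hb.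
  assert (HS : Cmod (A 0%nat) ^ 2 <= Rsum (fun k => Cmod (A k) ^ 2) n).
  { generalize (Rsum_le_add (fun k => Cmod (A k) ^ 2) 0 n ltac:(intros; apply pow2_ge_0)).
    now rewrite sum_O. }
  assert (H0 := H (RtoC 0)). rewrite Cmult_0_l, Cplus_0_r, Cmod_0 in H0.
  set (S := Rsum _ _) in *.
  destruct (Rle_lt_dec 1 (Cmod (A 0%nat) ^ 2)) as [H1|H1]; [nra|].
  set (d := 1 - Cmod (A 0%nat) ^ 2) in *. assert (Hd : 0 < d) by (unfold d; lra).
  (* This [tau] minimizes [1 + |tau|^2 - |A (n + 1) + tau A 0|^2]; for it,
     [A (n + 1) + tau A 0 = A (n + 1) / d]. *)
  specialize (H (RtoC (/ d) * (A (Datatypes.S n) * Cconj (A 0%nat)))%C).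
  replace (A (Datatypes.S n) + RtoC (/ d) * (A (Datatypes.S n) * Cconj (A 0%nat)) * A 0%nat)%C
    with (RtoC (/ d) * A (Datatypes.S n))%C in H.
  - rewrite !Cmod_mult, Cmod_R, Cmod_conj in H.
    rewrite (Rabs_pos_eq (/ d)) in H by (apply Rlt_le, Rinv_0_lt_compat; lra).
    apply Rmult_le_compat_l with (r := d * d) in H; [|nra].
    set (b := Cmod (A (Datatypes.S n))) in *. set (a := Cmod (A 0%nat)) in *.
    replace (d * d * (S + (/ d * b) ^ 2)) with (d * d * S + b ^ 2) in H by (field; lra).
    replace (d * d * (1 + (/ d * (b * a)) ^ 2)) with (d * d + b ^ 2 * a ^ 2) in H by (field; lra).
    apply Rmult_le_reg_l with (1 := Hd).
    replace (a ^ 2) with (1 - d) in * by (unfold d; ring). nra.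
  - replace (RtoC (/ d) * (A (Datatypes.S n) * Cconj (A 0%nat)) * A 0%nat)%C
      with (RtoC (/ d) * A (Datatypes.S n) * (A 0%nat * Cconj (A 0%nat)))%C by ring.
    rewrite <- Cmod2_conj.
    replace (Cmod (A 0%nat) ^ 2) with (1 - d) by (unfold d; ring).
    transitivity (A (Datatypes.S n) * (RtoC (1 + / d * (1 - d))))%C.
    + replace (1 + / d * (1 - d)) with (/ d) by (field; lra). ring.
    + rewrite RtoC_plus, RtoC_mult. ring.
Qed.

(** * Lacunary series *)

Lemma Rsum_le_loc (u v : nat -> R) (n : nat) :
  (forall k, (k <= n)%nat -> u k <= v k) -> Rsum u n <= Rsum v n.
Proof.
  induction n as [|n IH]; intros H; [rewrite !sum_O; now apply H|].
  rewrite !Rsum_S. apply Rplus_le_compat; [apply IH; auto|now apply H].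
Qed.

Lemma in_disc_polar (s t : R) : 0 <= s < 1 -> in_disc (s * cis t)%C.
Proof.
  intros Hs. unfold in_disc. rewrite Cmod_mult, Cmod_cis, Cmod_R, Rabs_pos_eq; lra.
Qed.

(** Abel's lemma: at an intermediate radius [t] the terms are eventually bounded, being differences
    of nearby partial sums, and passing from [t] to [s] gains a geometric factor. *)
Lemma lacunary_abs_summable (p m : nat) (a : nat -> C) (h : C -> C) (s : R) :
  (1 <= p)%nat -> lacunary_expansion p m a h -> 0 <= s < 1 ->
  ex_series (fun k => Cmod (a (p * k + m)%nat) * s ^ (p * k + m)).
Proof.
  intros Hp Ha Hs.
  set (t := (1 + s) / 2). assert (Ht : s < t < 1) by (unfold t; lra).
  assert (Hz : in_disc (RtoC t)).
  { unfold in_disc. rewrite Cmod_R, Rabs_pos_eq; lra. }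
  specialize (Ha _ Hz).
  destruct (is_series_Cmod _ _ (1 / 2) ltac:(lra) Ha) as [N HN].
  apply (ex_series_incr_n _ (S N)).
  apply (ex_series_le (K := R_AbsRing) (V := R_CompleteNormedModule) _ (fun k => (s / t) ^ k)).
  2:{ apply ex_series_geom. rewrite Rabs_pos_eq.
      - apply Rmult_lt_reg_r with t; [lra|]. field_simplify; lra.
      - apply Rdiv_le_0_compat; lra. }
  intros k. set (j := (N + k)%nat). replace (S N + k)%nat with (S j) by (unfold j; lia).
  set (e := (p * S j + m)%nat).
  assert (HB : Cmod (a e) * t ^ e <= 1).
  { assert (H1 := HN j ltac:(unfold j; lia)). assert (H2 := HN (S j) ltac:(unfold j; lia)).
    rewrite sum_Sn in H2. fold e in H2. set (l := h _) in *.
    replace (Cmod (a e) * t ^ e) with (Cmod (a e * t ^ e)%C).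
    2:{ rewrite Cmod_mult, Cmod_pow, Cmod_R, Rabs_pos_eq; lra. }
    set (S1 := Csum _ j) in *. unfold plus in H2; simpl (AbelianMonoid.plus _ _ _) in H2.
    replace (a e * t ^ e)%C with ((S1 + a e * t ^ e - l) + - (S1 - l))%C by Cring.
    eapply Rle_trans; [apply Cmod_triangle|]. rewrite Cmod_opp.
    change (Cmod (S1 + a e * t ^ e - l)%C < 1 / 2) in H2. lra. }
  assert (Hst : 0 <= s / t <= 1).
  { split; [apply Rdiv_le_0_compat; lra|].
    apply Rmult_le_reg_r with t; [lra|]. field_simplify; lra. }
  assert (0 < t ^ e) by (apply pow_lt; lra).
  assert (0 <= s ^ e) by (apply pow_le; lra).
  change (Rabs (Cmod (a e) * s ^ e) <= (s / t) ^ k).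
  rewrite Rabs_pos_eq by (apply Rmult_le_pos; [apply Cmod_ge_0|assumption]).
  apply Rle_trans with ((s / t) ^ e).
  - unfold Rdiv. rewrite Rpow_mult_distr, pow_inv.
    apply Rmult_le_reg_r with (t ^ e); [assumption|].
    replace (s ^ e * / t ^ e * t ^ e) with (s ^ e * 1) by (field; lra).
    rewrite Rmult_assoc, (Rmult_comm (s ^ e)), <- Rmult_assoc, Rmult_comm.
    now apply Rmult_le_compat_l.
  - replace e with (k + (e - k))%nat by (unfold e, j; nia). rewrite pow_add.
    assert (0 <= (s / t) ^ k) by (apply pow_le; lra).
    assert ((s / t) ^ (e - k) <= 1) by (rewrite <- (pow1 (e - k)); now apply pow_incr).
    nra.
Qed.

(** Letting [s -> 1] from below removes the loss from staying inside the disc, both in coefficient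
    bounds and for suprema approached only at the boundary. *)
Lemma le_of_forall_pow_mult (B K : R) (n : nat) :
  (forall s, 0 < s < 1 -> s ^ n * B <= K) -> B <= K.
Proof.
  intros H.
  assert (HL : filterlim (fun s => s ^ n * B) (at_left 1) (locally (1 ^ n * B))).
  { apply (filterlim_filter_le_1 (F := locally 1)); [exact (filter_le_within (F := locally 1) (fun u => u < 1))|].
    apply (ex_derive_continuous (fun s => s ^ n * B)). auto_derive. trivial. }
  replace B with (1 ^ n * B) by (rewrite pow1; ring).
  apply (filterlim_le (F := at_left 1) (fun s => s ^ n * B) (fun _ => K) (1 ^ n * B) K).
  - exists (mkposreal 1 Rlt_0_1). intros s Hs Hs1. apply H.
    apply Rabs_def2 in Hs. unfold minus, plus, opp in Hs; simpl in Hs. lra.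
  - exact HL.
  - apply filterlim_const.
Qed.

(* Evaluating [h] at the points [s cis (t / p)], of modulus [s < 1], avoids dividing
   [h] by [z ^ m] and extracting roots; the loss [s ^ (p * n + m)] disappears as [s -> 1]. *)
Lemma lacunary_bohr (p m : nat) (a : nat -> C) (h : C -> C) (M r K : R) (n : nat) :
  (1 <= p)%nat -> lacunary_expansion p m a h ->
  (forall z, in_disc z -> Cmod (h z) <= M) -> 0 < M ->
  0 < r -> r ^ p <= 1 / 2 -> 1 <= K ->
  (forall a0, r ^ p <= a0 <= 1 -> moebius_bohr a0 (r ^ p) <= K) ->
  Rsum (fun k => Cmod (a (p * k + m)%nat) * r ^ (p * k + m)) n <= M * (r ^ m * K).
Proof.
  intros Hp Ha HM HM0 Hr Hrho HK HMB.
  apply le_of_forall_pow_mult with (p * n + m)%nat. intros s Hs.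
  (* Up to the factor [s^m / M], these are the coefficients of [phi (s^p w)], where
     [h z = z^m phi (z^p)]; in [F] the factor [cis (- m t / p)] cancels the phase of [z^m]. *)
  set (A := fun k => (a (p * k + m)%nat * RtoC (s ^ (p * k + m) / M))%C).
  assert (HCA : forall k, Cmod (A k) = Cmod (a (p * k + m)%nat) * s ^ (p * k + m) * / M).
  { intros k. unfold A. rewrite Cmod_mult, Cmod_R, Rabs_pos_eq.
    - unfold Rdiv. ring.
    - apply Rdiv_le_0_compat; [apply pow_le; lra|assumption]. }
  assert (HS : ex_series (fun k => Cmod (A k))).
  { eapply ex_series_ext; [intros k; symmetry; apply HCA|].
    apply (ex_series_scal_r (/ M)). apply lacunary_abs_summable with h; try assumption; lra. }
  assert (HpR : 0 < INR p) by (apply lt_0_INR; lia).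
  set (F := fun t => (cis (- (INR m * (t / INR p))) * RtoC (/ M) * h (s * cis (t / INR p)))%C).
  assert (HF : forall t, is_series (K := C_AbsRing) (V := C_NormedModule)
     (fun k => A k * cis t ^ k)%C (F t)).
  { intros t.
    apply is_series_ext with (fun k => scal (V := C_NormedModule)
      (cis (- (INR m * (t / INR p))) * RtoC (/ M))%C
      (a (p * k + m)%nat * (s * cis (t / INR p)) ^ (p * k + m))%C).
    - intros k. change (@scal C_AbsRing C_NormedModule) with Cmult.
      unfold A, Rdiv. rewrite Cpow_mult_l, !cis_pow, RtoC_mult, <- RtoC_pow.
      replace (cis (INR k * t)) with
        (cis (- (INR m * (t * / INR p))) * cis (INR (p * k + m) * (t * / INR p)))%C.
      + Cring.
      + rewrite <- cis_plus. f_equal. rewrite plus_INR, mult_INR. field. lra.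
    - apply (is_series_scal (K := C_AbsRing) (V := C_NormedModule)).
      apply Ha. apply in_disc_polar. lra. }
  assert (HF1 : forall t, Cmod (F t) <= 1).
  { intros t. unfold F. rewrite !Cmod_mult, Cmod_cis, Cmod_R, Rabs_pos_eq
      by (apply Rlt_le, Rinv_0_lt_compat; assumption).
    specialize (HM _ (in_disc_polar s (t / INR p) ltac:(lra))).
    apply Rmult_le_reg_l with M; [assumption|]. field_simplify; lra. }
  assert (HT := fun n tau => bounded_coeff_inequality A F n tau HS HF HF1).
  assert (HB := bohr_partial_sum_le (fun k => Cmod (A k)) (r ^ p) K n
    ltac:(intros; apply Cmod_ge_0)).
  simpl (Cmod (A _)) in HB.
  assert (H1 : Rsum (fun k => Cmod (A k) * (r ^ p) ^ k) n <= K).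
  { apply HB; try assumption.
    - intros j. specialize (HT j (RtoC 0)). rewrite Cmod_0 in HT.
      generalize (pow2_ge_0 (Cmod (A (S j) + 0 * A 0%nat)%C)). lra.
    - intros j. apply schwarz_coeff_inequality. intros tau. apply HT.
    - split; [now apply pow_lt|assumption]. }
  assert (H2 : s ^ (p * n + m) * Rsum (fun k => Cmod (a (p * k + m)%nat) * r ^ (p * k + m)) n
     <= M * r ^ m * Rsum (fun k => Cmod (A k) * (r ^ p) ^ k) n).
  { rewrite <- !Rsum_mult_l. apply Rsum_le_loc. intros k Hk. rewrite HCA.
    replace (M * r ^ m * (Cmod (a (p * k + m)%nat) * s ^ (p * k + m) * / M * (r ^ p) ^ k))
      with (s ^ (p * k + m) * (Cmod (a (p * k + m)%nat) * r ^ (p * k + m))).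
    2:{ rewrite (pow_add r), pow_mult. field. lra. }
    apply Rmult_le_compat_r.
    - apply Rmult_le_pos; [apply Cmod_ge_0|apply pow_le; lra].
    (* As [k <= n], the single factor [s^(p n + m)] lies below every [s^(p k + m)]. *)
    - replace (p * n + m)%nat with (p * k + m + p * (n - k))%nat by nia.
      rewrite pow_add. assert (0 < s ^ (p * k + m)) by (apply pow_lt; lra).
      assert (s ^ (p * (n - k)) <= 1) by (rewrite <- (pow1 (p * (n - k))); apply pow_incr; lra).
      nra. }
  apply Rle_trans with (1 := H2). rewrite Rmult_assoc.
  apply Rmult_le_compat_l; [lra|]. apply Rmult_le_compat_l; [apply pow_le; lra|assumption].
Qed.

Lemma pow_lt_compat (x y : R) (n : nat) : 0 <= x < y -> (1 <= n)%nat -> x ^ n < y ^ n.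
Proof.
  intros Hx Hn. destruct n as [|n]; [lia|]. simpl.
  assert (x ^ n <= y ^ n) by (apply pow_incr; lra).
  assert (0 < y ^ n) by (apply pow_lt; lra). nra.
Qed.

(** * Sup norms and reduction of the Bohr inequality to a bound on [moebius_bohr] *)

Lemma sup_norm_ub (h : C -> C) : bounded_on_disc h ->
  forall z, in_disc z -> Cmod (h z) <= sup_norm h.
Proof.
  intros [M HM] z Hz. unfold sup_norm.
  destruct (Lub_Rbar_correct (fun x => exists z, in_disc z /\ x = Cmod (h z))) as [Hub Hl].
  set (L := Lub_Rbar _) in *.
  assert (H1 : Rbar_le (Cmod (h z)) L) by (apply Hub; now exists z).
  assert (H2 : Rbar_le L M) by (apply Hl; intros x [w [Hw ->]]; now apply HM).
  (* The two bounds rule out the infinite values, for which [real] would return [0]. *)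
  destruct L; simpl in *; tauto.
Qed.

Lemma sup_norm_eq_1 (h : C -> C) :
  (forall z, in_disc z -> Cmod (h z) <= 1) ->
  (exists n, forall s, 0 < s < 1 -> exists z, in_disc z /\ s ^ n <= Cmod (h z)) ->
  sup_norm h = 1.
Proof.
  intros H1 [n Hn].
  apply Rle_antisym.
  - unfold sup_norm.
    destruct (Lub_Rbar_correct (fun x => exists z, in_disc z /\ x = Cmod (h z))) as [Hub Hl].
    set (L := Lub_Rbar _) in *.
    assert (H2 : Rbar_le L 1) by (apply Hl; intros x [w [Hw ->]]; now apply H1).
    destruct L; simpl in *; lra.
  - apply le_of_forall_pow_mult with n. intros s Hs. rewrite Rmult_1_r.
    destruct (Hn s Hs) as [z [Hz Hle]]. apply Rle_trans with (1 := Hle).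
    apply sup_norm_ub; [now exists 1|assumption].
Qed.

Lemma lacunary_series_le (p m : nat) (a : nat -> C) (h : C -> C) (r0 r : R) :
  (1 <= p)%nat -> lacunary_expansion p m a h -> bounded_on_disc h ->
  0 < r0 < 1 -> r0 ^ p <= 1 / 2 ->
  (forall a0, r0 ^ p <= a0 <= 1 -> r0 ^ m * moebius_bohr a0 (r0 ^ p) <= 1 / 2) ->
  0 <= r <= r0 ->
  Series (fun k => Cmod (a (p * k + m)%nat) * r ^ (p * k + m)) <= sup_norm h / 2.
Proof.
  intros Hp Ha Hb Hr0 Hrho HM Hr.
  assert (Hm : 0 < r0 ^ m) by (apply pow_lt; lra).
  assert (H0 : 0 <= sup_norm h).
  { apply Rle_trans with (Cmod (h (RtoC 0))); [apply Cmod_ge_0|].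
    apply sup_norm_ub; [assumption|]. unfold in_disc. rewrite Cmod_0. lra. }
  apply Rle_trans with (Series (fun k => Cmod (a (p * k + m)%nat) * r0 ^ (p * k + m))).
  { apply Series_le; [|apply lacunary_abs_summable with h; trivial; lra].
    intros k. split.
    - apply Rmult_le_pos; [apply Cmod_ge_0|apply pow_le; lra].
    - apply Rmult_le_compat_l; [apply Cmod_ge_0|apply pow_incr; lra]. }
  apply Series_le_bound; [apply lacunary_abs_summable with h; trivial; lra|].
  (* [lacunary_bohr] divides by its bound, and [sup_norm h] may be [0]; hence the bound
     [sup_norm h + 2 * e]. *)
  intros n. apply le_epsilon. intros e He.
  assert (HK : forall a0, r0 ^ p <= a0 <= 1 -> moebius_bohr a0 (r0 ^ p) <= 1 / 2 / r0 ^ m).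
  { intros a0 Ha0. apply Rmult_le_reg_l with (1 := Hm).
    replace (r0 ^ m * (1 / 2 / r0 ^ m)) with (1 / 2) by (field; lra). now apply HM. }
  assert (HK1 : 1 <= 1 / 2 / r0 ^ m).
  { replace 1 with (moebius_bohr 1 (r0 ^ p)) at 1.
    - apply HK. split; lra.
    - unfold moebius_bohr. field. lra. }
  replace (sup_norm h / 2 + e)
    with ((sup_norm h + 2 * e) * (r0 ^ m * (1 / 2 / r0 ^ m))) by (field; lra).
  apply lacunary_bohr with h; try assumption; try lra.
  intros z Hz. generalize (sup_norm_ub h Hb z Hz). lra.
Qed.

Lemma B_H_split (p m : nat) (a b : nat -> C) (h g : C -> C) (r : R) :
  (1 <= p)%nat -> lacunary_expansion p m a h -> lacunary_expansion p m b g ->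
  0 <= r < 1 ->
  B_H p m a b r = Series (fun k => Cmod (a (p * k + m)%nat) * r ^ (p * k + m))
    + Series (fun k => Cmod (b (p * k + m)%nat) * r ^ (p * k + m)).
Proof.
  intros Hp Ha Hb Hr. unfold B_H. rewrite <- Series_plus.
  - apply Series_ext. intros k. ring.
  - now apply lacunary_abs_summable with h.
  - now apply lacunary_abs_summable with g.
Qed.

Lemma bohr_inequality_of_moebius (p m : nat) (r0 : R) :
  (1 <= p)%nat -> 0 < r0 < 1 -> r0 ^ p <= 1 / 2 ->
  (forall a0, r0 ^ p <= a0 <= 1 -> r0 ^ m * moebius_bohr a0 (r0 ^ p) <= 1 / 2) ->
  bohr_inequality_up_to p m r0.
Proof.
  intros Hp Hr0 Hrho HM f h g a b [_ _ _ _ Ha Hb Hbh Hbg] r Hr.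
  rewrite (B_H_split p m a b h g) by (trivial; lra).
  generalize (lacunary_series_le p m a h r0 r Hp Ha Hbh Hr0 Hrho HM Hr)
    (lacunary_series_le p m b g r0 r Hp Hb Hbg Hr0 Hrho HM Hr)
    (Rmax_l (sup_norm h) (sup_norm g)) (Rmax_r (sup_norm h) (sup_norm g)).
  unfold max_norm. lra.
Qed.

(** * The Moebius majorant and the radius equation *)

Lemma moebius_bohr_le_1 (a rho : R) : 0 < rho <= 1 / 3 -> 0 <= a <= 1 ->
  moebius_bohr a rho <= 1.
Proof.
  intros Hr Ha. unfold moebius_bohr.
  assert (0 < 1 - a * rho) by nra.
  apply Rmult_le_reg_r with (1 - a * rho); [assumption|]. field_simplify; [|lra].
  (* This is the numerator of [1 - moebius_bohr a rho]; its second factor is nonnegative up to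
     [a = 1] exactly when [rho <= 1/3]. *)
  assert (0 <= (1 - a) * (1 - rho - 2 * a * rho)) by (apply Rmult_le_pos; nra).
  nra.
Qed.

Lemma moebius_bohr_incr (a rho sigma : R) : 0 <= a <= 1 -> 0 <= rho <= sigma -> sigma < 1 ->
  moebius_bohr a rho <= moebius_bohr a sigma.
Proof.
  intros Ha Hr Hs. unfold moebius_bohr. apply Rplus_le_compat_l.
  assert (a * sigma < 1) by nra. assert (a * rho < 1) by nra.
  apply Rminus_le_0.
  replace (_ - _) with ((sigma - rho) * (1 - a ^ 2) / ((1 - a * rho) * (1 - a * sigma)))
    by (field; lra).
  apply Rdiv_le_0_compat; [apply Rmult_le_pos; nra|apply Rmult_lt_0_compat; lra].
Qed.

Definition radius_poly (p m : nat) (r : R) : R :=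
  - 12 * r ^ (p - m) + r ^ (2 * (p - m)) + 32 * r ^ (2 * p) + 4.

Lemma radius_poly_square (p m : nat) (r : R) :
  radius_poly p m r = (6 - r ^ (p - m)) ^ 2 - 32 * (1 - (r ^ p) ^ 2).
Proof.
  unfold radius_poly. rewrite !(Nat.mul_comm 2), !pow_mult. ring.
Qed.

Lemma rho_moebius_bohr (a rho : R) : 0 < 1 - a * rho ->
  rho * moebius_bohr a rho
  = 3 - 2 * (1 - a * rho) - (1 - rho ^ 2) / (1 - a * rho).
Proof. intros H. unfold moebius_bohr. field. lra. Qed.

(** Multiplying by [x = s^(p - m)] turns [s^m] into [rho = s^p] and the claim into
    [6 - x <= 4 u + 2 v / u]. By the arithmetic-geometric mean inequality
    [(4 u + 2 v / u)^2 >= 32 v], while the sign hypothesis says [(6 - x)^2 <= 32 v]. *)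
Lemma moebius_bohr_of_radius_poly (p m : nat) (s a : R) :
  (m <= p)%nat -> (1 <= p)%nat -> 0 < s < 1 -> radius_poly p m s <= 0 -> 0 <= a <= 1 ->
  s ^ m * moebius_bohr a (s ^ p) <= 1 / 2.
Proof.
  intros Hmp Hp Hs HF Ha. rewrite radius_poly_square in HF.
  assert (Hrho : 0 < s ^ p < 1).
  { split; [apply pow_lt; lra|]. apply pow_lt_1_compat; [lra|lia]. }
  assert (Hx : 0 < s ^ (p - m)) by (apply pow_lt; lra).
  assert (E : s ^ p = s ^ (p - m) * s ^ m) by (rewrite <- pow_add; f_equal; lia).
  assert (Hu : 0 < 1 - a * s ^ p) by nra.
  apply Rmult_le_reg_l with (1 := Hx). rewrite <- Rmult_assoc, <- E, rho_moebius_bohr by lra.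
  set (x := s ^ (p - m)) in *. set (v := 1 - (s ^ p) ^ 2) in *. set (u := 1 - a * s ^ p) in *.
  assert (Hv : 0 < v) by (unfold v; nra).
  assert (Hvu : 0 < v / u) by (apply Rdiv_lt_0_compat; assumption).
  assert (Ev : v = v / u * u) by (field; lra).
  set (t := v / u) in *.
  assert (6 - x <= 4 * u + 2 * t); [|lra].
  apply Rnot_lt_le. intros HC.
  assert ((4 * u + 2 * t) ^ 2 < (6 - x) ^ 2) by nra.
  generalize (pow2_ge_0 (4 * u - 2 * t)). nra.
Qed.

(** The parameter is the equality case [4 u = 2 v / u]: here [u = 1 - a rho] is [q] with
    [2 q^2 = 1 - rho^2], and the radius equation becomes [6 - x = 8 q]. *)
Lemma extremal_parameter_spec (p m : nat) (r : R) :
  (m <= p)%nat -> (1 <= p)%nat -> 0 < r < 1 -> radius_poly p m r = 0 -> 1 / 3 <= r ^ p ->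
  0 < extremal_parameter p r <= 1 /\
  r ^ m * moebius_bohr (extremal_parameter p r) (r ^ p) = 1 / 2.
Proof.
  intros Hmp Hp Hr HF H3. rewrite radius_poly_square in HF.
  assert (Hrho : 0 < r ^ p < 1).
  { split; [apply pow_lt; lra|]. apply pow_lt_1_compat; [lra|lia]. }
  assert (Hx : 0 < r ^ (p - m) <= 1).
  { split; [apply pow_lt; lra|]. rewrite <- (pow1 (p - m)). apply pow_incr; lra. }
  assert (E : r ^ p = r ^ (p - m) * r ^ m) by (rewrite <- pow_add; f_equal; lia).
  set (q := sqrt (1 - r ^ (2 * p)) / sqrt 2).
  assert (Ea : extremal_parameter p r = (1 - q) / r ^ p).
  { unfold extremal_parameter, q. assert (0 < sqrt 2) by (apply sqrt_lt_R0; lra). field. split; lra. }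
  assert (Hv : 0 < 1 - (r ^ p) ^ 2) by nra.
  assert (Hq : 0 < q).
  { apply Rdiv_lt_0_compat; apply sqrt_lt_R0; [|lra].
    now rewrite Nat.mul_comm, pow_mult. }
  assert (Hq2 : 2 * q ^ 2 = 1 - (r ^ p) ^ 2).
  { unfold q, Rdiv. rewrite Rpow_mult_distr, pow_inv, !pow2_sqrt.
    - rewrite Nat.mul_comm, pow_mult. field.
    - lra.
    - rewrite Nat.mul_comm, pow_mult. lra. }
  rewrite Ea. set (rho := r ^ p) in *. set (x := r ^ (p - m)) in *.
  assert (Hq1 : q < 1) by nra.
  split.
  - split; [apply Rdiv_lt_0_compat; lra|].
    (* [a <= 1] amounts to [1 - rho <= q], that is [2 (1 - rho)^2 <= 1 - rho^2], which is
       [1/3 <= rho]. *)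
    apply Rmult_le_reg_r with rho; [lra|]. unfold Rdiv. rewrite Rmult_assoc, Rinv_l by lra.
    nra.
  - apply Rmult_eq_reg_l with x; [|lra]. rewrite <- Rmult_assoc, <- E.
    assert (Eq : (1 - q) / rho * rho = 1 - q) by (field; lra).
    rewrite rho_moebius_bohr; rewrite Eq; [|lra].
    rewrite <- Hq2.
    replace (2 * q ^ 2 / (1 - (1 - q))) with (2 * q) by (field; lra).
    nra.
Qed.

(** No calculus on the polynomial is needed: were it nonpositive at [s], the bound [1/2] would hold
    at [s] for the parameter extremal at [r], yet with this parameter fixed the value is already
    [1/2] at [r] and strictly larger at [s]. *)
Lemma radius_root_is_maximal (p m : nat) (r s : R) :
  (1 <= m <= p)%nat -> 0 < r < 1 -> radius_poly p m r = 0 -> 1 / 3 <= r ^ p ->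
  r < s < 1 -> 0 < radius_poly p m s.
Proof.
  intros Hmp Hr HF H3 Hs. apply Rnot_le_lt. intros HC.
  destruct (extremal_parameter_spec p m r) as [Ha HE]; try assumption; try lia.
  set (a := extremal_parameter p r) in *.
  assert (HU := moebius_bohr_of_radius_poly p m s a ltac:(lia) ltac:(lia) ltac:(lra) HC ltac:(lra)).
  assert (H1 : r ^ p <= s ^ p) by (apply pow_incr; lra).
  assert (H2 : 0 < r ^ m < s ^ m).
  { split; [apply pow_lt; lra|]. apply pow_lt_compat; [lra|lia]. }
  assert (H4 : 0 < s ^ p < 1).
  { split; [apply pow_lt; lra|]. apply pow_lt_1_compat; [lra|lia]. }
  assert (HM := moebius_bohr_incr a (r ^ p) (s ^ p) ltac:(lra) ltac:(lra) ltac:(lra)).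
  assert (0 < moebius_bohr a (r ^ p)) by nra.
  assert (r ^ m * moebius_bohr a (r ^ p) < s ^ m * moebius_bohr a (r ^ p))
    by (apply Rmult_lt_compat_r; lra).
  assert (s ^ m * moebius_bohr a (r ^ p) <= s ^ m * moebius_bohr a (s ^ p))
    by (apply Rmult_le_compat_l; lra).
  lra.
Qed.

(** * The two ranges of [p / m] *)

Lemma div_gt_log2_3 (m p : nat) : (1 <= m)%nat -> INR p / INR m > log2 3 -> 3 ^ m < 2 ^ p.
Proof.
  intros Hm H. unfold log2 in H.
  assert (HmR : 0 < INR m) by (apply lt_0_INR; lia).
  assert (H2 : 0 < ln 2) by (rewrite <- ln_1; apply ln_increasing; lra).
  apply ln_lt_inv; [apply pow_lt; lra|apply pow_lt; lra|].
  rewrite !ln_pow by lra.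
  apply Rmult_lt_compat_r with (r := INR m * ln 2) in H; [|nra].
  replace (ln 3 / ln 2 * (INR m * ln 2)) with (INR m * ln 3) in H by (field; lra).
  replace (INR p / INR m * (INR m * ln 2)) with (INR p * ln 2) in H by (field; lra).
  exact H.
Qed.

Lemma div_le_log2_3 (m p : nat) : (1 <= m)%nat -> INR p / INR m <= log2 3 -> 2 ^ p <= 3 ^ m.
Proof.
  intros Hm H. unfold log2 in H.
  assert (HmR : 0 < INR m) by (apply lt_0_INR; lia).
  assert (H2 : 0 < ln 2) by (rewrite <- ln_1; apply ln_increasing; lra).
  apply Rnot_lt_le. intros HC. apply ln_increasing in HC; [|apply pow_lt; lra].
  rewrite !ln_pow in HC by lra.
  apply Rmult_le_compat_r with (r := INR m * ln 2) in H; [|nra].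
  replace (ln 3 / ln 2 * (INR m * ln 2)) with (INR m * ln 3) in H by (field; lra).
  replace (INR p / INR m * (INR m * ln 2)) with (INR p * ln 2) in H by (field; lra).
  lra.
Qed.

Lemma div_ge_1 (m p : nat) : (1 <= m)%nat -> 1 <= INR p / INR m -> (m <= p)%nat.
Proof.
  intros Hm H. apply INR_le.
  assert (HmR : 0 < INR m) by (apply lt_0_INR; lia).
  apply Rmult_le_compat_r with (r := INR m) in H; [|lra].
  replace (INR p / INR m * INR m) with (INR p) in H by (field; lra). lra.
Qed.

Lemma Rpower_inv_INR (x : R) (n : nat) : 0 < x -> (1 <= n)%nat ->
  Rpower x (1 / INR n) ^ n = x.
Proof.
  intros Hx Hn.
  assert (HnR : 0 < INR n) by (apply lt_0_INR; lia).
  rewrite <- Rpower_pow by apply exp_pos. rewrite Rpower_mult.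
  replace (1 / INR n * INR n) with 1 by (field; lra). now apply Rpower_1.
Qed.

Lemma pow_lt_inv (x y : R) (n : nat) : 0 <= x -> 0 <= y -> x ^ n < y ^ n -> x < y.
Proof.
  intros Hx Hy H. apply Rnot_le_lt. intros HC.
  assert (y ^ n <= x ^ n) by (apply pow_incr; lra). lra.
Qed.

Lemma pow_le_inv (x y : R) (n : nat) : 0 <= x -> 0 <= y -> (1 <= n)%nat ->
  x ^ n <= y ^ n -> x <= y.
Proof.
  intros Hx Hy Hn H. apply Rnot_lt_le. intros HC.
  assert (y ^ n < x ^ n) by (apply pow_lt_compat; [lra|lia]). lra.
Qed.

Lemma bohr_inequality_large_p (m p : nat) :
  (1 <= m)%nat -> (1 <= p)%nat -> INR p / INR m > log2 3 ->
  bohr_inequality_up_to p m (Rpower (1 / 2) (1 / INR m)).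
Proof.
  intros Hm Hp H.
  set (r := Rpower _ _).
  assert (Er : r ^ m = 1 / 2) by (apply Rpower_inv_INR; [lra|lia]).
  assert (Hr : 0 < r) by apply exp_pos.
  assert (Hr1 : r < 1).
  { apply pow_lt_inv with m; try lra. rewrite Er, pow1. lra. }
  assert (Hrho : 0 < r ^ p) by now apply pow_lt.
  (* Compare [m]-th powers: [(r^p)^m = (1/2)^p < (1/3)^m]. *)
  assert (H3 : r ^ p < 1 / 3).
  { apply pow_lt_inv with m; try lra.
    rewrite <- pow_mult, Nat.mul_comm, pow_mult, Er.
    unfold Rdiv. rewrite !Rmult_1_l, !pow_inv.
    apply Rinv_lt_contravar; [|now apply div_gt_log2_3].
    apply Rmult_lt_0_compat; apply pow_lt; lra. }
  apply bohr_inequality_of_moebius; [lia|lra|lra|].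
  intros a Ha. rewrite Er.
  generalize (moebius_bohr_le_1 a (r ^ p) ltac:(lra) ltac:(lra)). lra.
Qed.

(** The search starts at [r^p = 1/3], so the root inherits the lower bound that keeps the extremal
    parameter at most [1]. There [r^m <= 1/2] gives [x >= 2/3], hence
    [(6 - x)^2 <= 256/9 = 32 (1 - 1/9)]; at [1] the polynomial equals [25]. *)
Lemma radius_root_exists (m p : nat) :
  (1 <= m <= p)%nat -> INR p / INR m <= log2 3 ->
  exists r, 0 < r < 1 /\ radius_poly p m r = 0 /\ 1 / 3 <= r ^ p.
Proof.
  intros Hmp H.
  set (r := Rpower (1 / 3) (1 / INR p)).
  assert (Er : r ^ p = 1 / 3) by (apply Rpower_inv_INR; [lra|lia]).
  assert (Hr : 0 < r) by apply exp_pos.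
  assert (Hr1 : r < 1).
  { apply pow_lt_inv with p; try lra. rewrite Er, pow1. lra. }
  assert (H2 : 0 < r ^ m) by now apply pow_lt.
  assert (H2' : r ^ m <= 1 / 2).
  { apply pow_le_inv with p; try lra; [lia|].
    rewrite <- pow_mult, Nat.mul_comm, pow_mult, Er.
    unfold Rdiv. rewrite !Rmult_1_l, !pow_inv.
    apply Rinv_le_contravar; [apply pow_lt; lra|]. apply div_le_log2_3; [lia|assumption]. }
  assert (E : r ^ p = r ^ (p - m) * r ^ m) by (rewrite <- pow_add; f_equal; lia).
  assert (HF : radius_poly p m r <= 0).
  { rewrite radius_poly_square, Er. rewrite Er in E.
    assert (r ^ (p - m) <= 1) by (rewrite <- (pow1 (p - m)); apply pow_incr; lra).
    assert (2 / 3 <= r ^ (p - m)) by nra. nra. }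
  destruct (Rle_lt_or_eq_dec _ _ HF) as [HF1|HF1].
  - destruct (IVT (radius_poly p m) r 1) as [z [Hz HFz]].
    + unfold radius_poly. reg.
    + assumption.
    + assumption.
    + unfold radius_poly. rewrite !pow1. lra.
    + exists z.
      assert (z <> 1).
      { intros ->. unfold radius_poly in HFz. rewrite !pow1 in HFz. lra. }
      split; [lra|]. split; [assumption|].
      rewrite <- Er. apply pow_incr. lra.
  - exists r. repeat split; try lra; assumption.
Qed.

Lemma bohr_inequality_small_p (m p : nat) (r : R) :
  (1 <= m <= p)%nat -> 0 < r < 1 -> radius_poly p m r = 0 -> bohr_inequality_up_to p m r.
Proof.
  intros Hmp Hr HF.
  assert (HM : forall a, 0 <= a <= 1 -> r ^ m * moebius_bohr a (r ^ p) <= 1 / 2).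
  { intros a Ha. apply moebius_bohr_of_radius_poly; try lia; lra. }
  assert (Hrho : 0 < r ^ p < 1).
  { split; [apply pow_lt; lra|]. apply pow_lt_1_compat; [lra|lia]. }
  apply bohr_inequality_of_moebius; [lia|lra| |intros a Ha; apply HM; lra].
  (* At [a = 1] the bound reads [r^m <= 1/2], and [m <= p] then gives the required [r^p <= 1/2]. *)
  assert (H1 := HM 1 ltac:(lra)).
  replace (moebius_bohr 1 (r ^ p)) with 1 in H1 by (unfold moebius_bohr; field; lra).
  replace p with (m + (p - m))%nat by lia. rewrite pow_add.
  assert (0 < r ^ m) by (apply pow_lt; lra).
  assert (r ^ (p - m) <= 1) by (rewrite <- (pow1 (p - m)); apply pow_incr; lra).
  nra.
Qed.

(** * Holomorphic functions and harmonicity *)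

Notation is_cderive := (@is_derive C_AbsRing C_NormedModule).

Lemma is_cderive_eps (F : C -> C) (z l : C) : is_cderive F z l <->
  forall eps, 0 < eps -> exists d, 0 < d /\
    forall w, Cmod (w - z) < d -> Cmod (F w - F z - (w - z) * l) <= eps * Cmod (w - z).
Proof.
  split.
  - intros [_ H] eps He.
    assert (Hz : is_filter_lim (@locally (NormedModule.UniformSpace _ (AbsRing_NormedModule C_AbsRing)) z) z)
      by (intros P HP; exact HP).
    destruct (H z Hz (mkposreal eps He)) as [d Hd].
    exists d. split; [apply cond_pos|]. intros w Hw. exact (Hd w Hw).
  - intros H. split; [apply (is_linear_scal_l (K := C_AbsRing) (V := C_NormedModule))|].
    intros x Hx eps.
    apply (is_filter_lim_locally_unique (K := C_AbsRing) (V := AbsRing_NormedModule C_AbsRing)) in Hx.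
    subst x.
    destruct (H eps (cond_pos eps)) as [d [Hd Hd']].
    exists (mkposreal d Hd). intros w Hw. exact (Hd' w Hw).
Qed.

Lemma is_cderive_plus (F G : C -> C) (z l k : C) : is_cderive F z l -> is_cderive G z k ->
  is_cderive (fun w => F w + G w)%C z (l + k)%C.
Proof. exact (is_derive_plus F G z l k). Qed.

(** Transfers between two module structures on [C] with convertible operations: the product and
    chain rules use one, the definition of analyticity the other. *)
Lemma is_derive_C_NormedModule (F : C -> C) (z l : C) :
  @is_derive C_AbsRing (AbsRing_NormedModule C_AbsRing) F z l <-> is_cderive F z l.
Proof.
  split; intros [[a b c] H]; (split; [split; assumption|exact H]).
Qed.

Lemma is_cderive_mult (F G : C -> C) (z l k : C) : is_cderive F z l -> is_cderive G z k ->
  is_cderive (fun w => F w * G w)%C z (l * G z + F z * k)%C.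
Proof.
  rewrite <- !is_derive_C_NormedModule. intros HF HG.
  exact (is_derive_mult (K := C_AbsRing) F G z l k HF HG Cmult_comm).
Qed.

Lemma is_cderive_const (c z : C) : is_cderive (fun _ => c) z (RtoC 0).
Proof. exact (is_derive_const (V := C_NormedModule) c z). Qed.

Lemma is_cderive_id (z : C) : is_cderive (fun w => w) z (RtoC 1).
Proof. apply is_derive_C_NormedModule. exact (is_derive_id (K := C_AbsRing) z). Qed.

Lemma is_cderive_inv (F : C -> C) (z l : C) : is_cderive F z l -> F z <> RtoC 0 ->
  is_cderive (fun w => / F w)%C z (- (l * (/ F z * / F z)))%C.
Proof.
  intros HF H0.
  assert (HI : is_cderive Cinv (F z) (- (/ F z * / F z))%C).
  { set (u := F z) in *. apply is_cderive_eps. intros eps He.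
    assert (Hu : 0 < Cmod u) by now apply Cmod_gt_0.
    set (c := Cmod u) in *.
    assert (Hc3 : 0 < c ^ 3) by now apply pow_lt.
    (* The first bound keeps [|w| > c / 2]; the second then makes the remainder factor
       [|w - u| / (|w| c^2)] at most [eps]. *)
    exists (Rmin (c / 2) (eps * c ^ 3 / 2)). split.
    { apply Rmin_glb_lt; [lra|]. assert (0 < eps * c ^ 3) by now apply Rmult_lt_0_compat. lra. }
    intros w Hw. apply Rmin_Rgt in Hw as [Hw1 Hw2].
    assert (Hwc : c / 2 < Cmod w).
    { assert (c <= Cmod w + Cmod (w - u)); [|lra].
      unfold c. replace u with (w + - (w - u))%C at 1 by ring.
      eapply Rle_trans; [apply Cmod_triangle|]. rewrite Cmod_opp. lra. }
    assert (Hw0 : w <> RtoC 0) by (apply Cmod_gt_0; lra).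
    replace (/ w - / u - (w - u) * - (/ u * / u))%C
      with ((w - u) * ((w - u) * / (w * (u * u))))%C by (field; auto).
    rewrite !Cmod_mult, Cmod_inv by (repeat apply Cmult_neq_0; assumption).
    rewrite !Cmod_mult. fold c. rewrite (Rmult_comm eps).
    apply Rmult_le_compat_l; [apply Cmod_ge_0|].
    assert (0 < Cmod w * (c * c)) by (repeat apply Rmult_lt_0_compat; lra).
    apply Rmult_le_reg_r with (Cmod w * (c * c)); [assumption|].
    rewrite Rmult_assoc, Rinv_l by lra.
    assert (c / 2 * (c * c) <= Cmod w * (c * c)) by (apply Rmult_le_compat_r; nra).
    assert (eps * (c / 2 * (c * c)) <= eps * (Cmod w * (c * c)))
      by (apply Rmult_le_compat_l; lra).
    simpl in Hw2. lra. }
  apply is_derive_C_NormedModule in HF.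
  generalize (is_derive_comp (K := C_AbsRing) (V := C_NormedModule) Cinv F z _ l HI HF).
  change (@scal C_AbsRing C_NormedModule) with Cmult.
  replace (l * - (/ F z * / F z))%C with (- (l * (/ F z * / F z)))%C by ring.
  trivial.
Qed.

(** Carries [n] successive derivatives on the disc, the last one continuous. The recursion parallels
    that of [ex_diff_n], and explicit derivatives make C^2 regularity accessible without Cauchy's
    theory. *)
Fixpoint holomorphic_n (n : nat) (F : C -> C) : Prop :=
  match n with
  | O => forall z, in_disc z -> forall eps, 0 < eps ->
      exists d, 0 < d /\ forall w, Cmod (w - z) < d -> Cmod (F w - F z) < eps
  | S n => exists F1 : C -> C, (forall z, in_disc z -> is_cderive F z (F1 z)) /\ holomorphic_n n F1
  end.

Lemma is_cderive_continuous (F : C -> C) (z l : C) : is_cderive F z l ->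
  forall eps, 0 < eps ->
    exists d, 0 < d /\ forall w, Cmod (w - z) < d -> Cmod (F w - F z) < eps.
Proof.
  intros H eps He. destruct (proj1 (is_cderive_eps F z l) H 1 Rlt_0_1) as [d [Hd H1]].
  assert (Hl := Cmod_ge_0 l).
  exists (Rmin d (eps / (1 + Cmod l))). split.
  { apply Rmin_glb_lt; [assumption|]. apply Rdiv_lt_0_compat; lra. }
  intros w Hw. apply Rmin_Rgt in Hw as [Hw1 Hw2].
  replace (F w - F z)%C with ((F w - F z - (w - z) * l) + (w - z) * l)%C by ring.
  eapply Rle_lt_trans; [apply Cmod_triangle|]. rewrite Cmod_mult.
  specialize (H1 w Hw1).
  apply Rmult_lt_compat_r with (r := 1 + Cmod l) in Hw2; [|lra].
  unfold Rdiv in Hw2. rewrite Rmult_assoc, Rinv_l in Hw2 by lra. lra.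
Qed.

Lemma holomorphic_n_le (n : nat) (F : C -> C) : holomorphic_n (S n) F -> holomorphic_n n F.
Proof.
  revert F. induction n as [|n IH]; intros F [F1 [H1 H2]].
  - intros z Hz. now apply is_cderive_continuous with (F1 z), H1.
  - exists F1. split; [assumption|]. now apply IH.
Qed.

Lemma holomorphic_n_continuous (n : nat) (F : C -> C) : holomorphic_n n F -> holomorphic_n 0 F.
Proof. induction n as [|n IH]; intros H; [exact H|]. now apply IH, holomorphic_n_le. Qed.

Lemma holomorphic_n_const (n : nat) (c : C) : holomorphic_n n (fun _ => c).
Proof.
  cut (holomorphic_n (S n) (fun _ => c)); [apply holomorphic_n_le|].
  revert c. induction n as [|n IH]; intros c; exists (fun _ => RtoC 0);
    (split; [intros; apply is_cderive_const|]).
  - intros z _ eps He. exists 1. split; [lra|]. intros w _.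
    replace (RtoC 0 - RtoC 0)%C with (RtoC 0) by ring. now rewrite Cmod_0.
  - apply IH.
Qed.

Lemma holomorphic_n_id (n : nat) : holomorphic_n n (fun z => z).
Proof.
  apply holomorphic_n_le. exists (fun _ => RtoC 1). split.
  - intros; apply is_cderive_id.
  - apply holomorphic_n_const.
Qed.

Lemma holomorphic_n_plus (n : nat) (F G : C -> C) :
  holomorphic_n n F -> holomorphic_n n G -> holomorphic_n n (fun z => F z + G z)%C.
Proof.
  revert F G. induction n as [|n IH]; intros F G HF HG.
  - intros z Hz eps He.
    destruct (HF z Hz (eps / 2) ltac:(lra)) as [d1 [Hd1 H1]].
    destruct (HG z Hz (eps / 2) ltac:(lra)) as [d2 [Hd2 H2]].
    exists (Rmin d1 d2). split; [now apply Rmin_glb_lt|].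
    intros w Hw. apply Rmin_Rgt in Hw as [Hw1 Hw2].
    replace (F w + G w - (F z + G z))%C with ((F w - F z) + (G w - G z))%C by ring.
    eapply Rle_lt_trans; [apply Cmod_triangle|].
    specialize (H1 w Hw1). specialize (H2 w Hw2). lra.
  - destruct HF as [F1 [HF HF1]], HG as [G1 [HG HG1]].
    exists (fun z => F1 z + G1 z)%C. split; [|now apply IH].
    intros z Hz. apply is_cderive_plus; auto.
Qed.

Lemma holomorphic_n_mult (n : nat) (F G : C -> C) :
  holomorphic_n n F -> holomorphic_n n G -> holomorphic_n n (fun z => F z * G z)%C.
Proof.
  revert F G. induction n as [|n IH]; intros F G HF HG.
  - intros z Hz eps He.
    assert (HFz := Cmod_ge_0 (F z)). assert (HGz := Cmod_ge_0 (G z)).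
    (* With increments below [e <= 1], the three terms of the product increment total less than
       [e * c]. *)
    set (c := 1 + Cmod (F z) + Cmod (G z)).
    set (e := Rmin 1 (eps / c)).
    assert (Hc : 0 < eps / c) by (apply Rdiv_lt_0_compat; unfold c; lra).
    assert (He0 : 0 < e) by (apply Rmin_glb_lt; lra).
    assert (He1 : e <= 1) by apply Rmin_l.
    assert (Hec : e * c <= eps).
    { apply Rle_trans with (eps / c * c); [|right; field; unfold c; lra].
      apply Rmult_le_compat_r; [unfold c; lra|apply Rmin_r]. }
    destruct (HF z Hz e He0) as [d1 [Hd1 H1]].
    destruct (HG z Hz e He0) as [d2 [Hd2 H2]].
    exists (Rmin d1 d2). split; [now apply Rmin_glb_lt|].
    intros w Hw. apply Rmin_Rgt in Hw as [Hw1 Hw2].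
    specialize (H1 w Hw1). specialize (H2 w Hw2).
    replace (F w * G w - F z * G z)%C with
      ((F w - F z) * (G w - G z) + (F w - F z) * G z + F z * (G w - G z))%C by ring.
    eapply Rle_lt_trans; [apply Cmod_triangle|].
    eapply Rle_lt_trans; [apply Rplus_le_compat_r, Cmod_triangle|].
    rewrite !Cmod_mult.
    assert (0 <= Cmod (F w - F z)) by apply Cmod_ge_0.
    assert (0 <= Cmod (G w - G z)) by apply Cmod_ge_0.
    unfold c in Hec. nra.
  - assert (HF' := holomorphic_n_le n F HF). assert (HG' := holomorphic_n_le n G HG).
    destruct HF as [F1 [HF HF1]], HG as [G1 [HG HG1]].
    exists (fun z => F1 z * G z + F z * G1 z)%C. split.
    + intros z Hz. apply is_cderive_mult; auto.
    + apply holomorphic_n_plus; now apply IH.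
Qed.

Lemma holomorphic_n_pow (n k : nat) : holomorphic_n n (fun z => z ^ k)%C.
Proof.
  induction k as [|k IH].
  - apply (holomorphic_n_const n (RtoC 1)).
  - apply (holomorphic_n_mult n (fun z => z) (fun z => z ^ k)%C); [apply holomorphic_n_id|exact IH].
Qed.

(** The extra derivative of [F] lets the base case deduce continuity of the inverse from its
    differentiability. *)
Lemma holomorphic_n_inv (n : nat) (F : C -> C) :
  holomorphic_n (S n) F -> (forall z, in_disc z -> F z <> RtoC 0) ->
  holomorphic_n n (fun z => / F z)%C.
Proof.
  intros HF H0. induction n as [|n IH].
  - destruct HF as [F1 [HF _]]. intros z Hz.
    exact (is_cderive_continuous _ z _ (is_cderive_inv F z _ (HF z Hz) (H0 z Hz))).
  - assert (HI := IH (holomorphic_n_le _ F HF)).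
    destruct HF as [F1 [HF HF1]].
    exists (fun z => - (1) * (F1 z * (/ F z * / F z)))%C. split.
    + intros z Hz.
      replace (- (1) * (F1 z * (/ F z * / F z)))%C with (- (F1 z * (/ F z * / F z)))%C by ring.
      exact (is_cderive_inv F z _ (HF z Hz) (H0 z Hz)).
    + apply (holomorphic_n_mult n (fun _ => - (1))%C); [apply holomorphic_n_const|].
      apply (holomorphic_n_mult n F1); [now apply holomorphic_n_le|].
      now apply holomorphic_n_mult.
Qed.

Lemma Cmod_le_abs (x y : R) : Cmod (x, y) <= Rabs x + Rabs y.
Proof.
  replace (x, y) with (RtoC x + Ci * RtoC y)%C.
  - eapply Rle_trans; [apply Cmod_triangle|].
    rewrite Cmod_mult, Cmod_Ci, !Cmod_R. lra.
  - apply injective_projections; simpl; ring.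
Qed.

Lemma in_disc_open (x y : R) : in_disc (x, y) -> locally_2d (fun u v => in_disc (u, v)) x y.
Proof.
  intros H. unfold in_disc in *.
  exists (mkposreal ((1 - Cmod (x, y)) / 2) ltac:(lra)). simpl. intros u v Hu Hv.
  replace (u, v) with (Cplus (x, y) (u - x, v - y))
    by (apply injective_projections; simpl; ring).
  eapply Rle_lt_trans; [apply Cmod_triangle|].
  generalize (Cmod_le_abs (u - x) (v - y)). lra.
Qed.

Lemma in_disc_open_x (x y : R) : in_disc (x, y) -> locally x (fun t => in_disc (t, y)).
Proof.
  intros H. destruct (in_disc_open x y H) as [d Hd]. exists d. intros t Ht.
  apply Hd; [exact Ht|]. rewrite Rminus_diag, Rabs_R0. apply cond_pos.
Qed.

Lemma in_disc_open_y (x y : R) : in_disc (x, y) -> locally y (fun t => in_disc (x, t)).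
Proof.
  intros H. destruct (in_disc_open x y H) as [d Hd]. exists d. intros t Ht.
  apply Hd; [|exact Ht]. rewrite Rminus_diag, Rabs_R0. apply cond_pos.
Qed.

(** Directions [1] and [Ci] yield the two partial derivatives, which encodes the Cauchy-Riemann
    equations. *)
Lemma is_derive_Re_line (F : C -> C) (z l c : C) : Cmod c = 1 -> is_cderive F z l ->
  is_derive (fun t : R => Re (F (z + t * c)%C)) 0 (Re (c * l)%C).
Proof.
  intros Hc HF. apply is_derive_Reals. intros eps He.
  destruct (proj1 (is_cderive_eps F z l) HF (eps / 2) ltac:(lra)) as [d [Hd H]].
  exists (mkposreal d Hd). intros h Hh Hhd. simpl in Hhd. rewrite Rplus_0_l.
  assert (E : (z + RtoC h * c - z)%C = (RtoC h * c)%C) by ring.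
  specialize (H (z + RtoC h * c)%C). rewrite E, Cmod_mult, Hc, Cmod_R, Rmult_1_r in H.
  specialize (H Hhd).
  replace (z + RtoC 0 * c)%C with z by ring.
  replace ((Re (F (z + RtoC h * c)%C) - Re (F z)) / h - Re (c * l))
    with (Re (F (z + RtoC h * c) - F z - RtoC h * c * l)%C / h).
  2:{ generalize (F (z + RtoC h * c)%C) (F z). intros A B.
      destruct A, B, c, l. simpl. field. assumption. }
  unfold Rdiv. rewrite Rabs_mult, Rabs_inv.
  assert (0 < Rabs h) by now apply Rabs_pos_lt.
  apply Rmult_lt_reg_r with (Rabs h); [assumption|].
  rewrite Rmult_assoc, Rinv_l by lra. rewrite Rmult_1_r.
  eapply Rle_lt_trans; [apply re_le_Cmod|].
  eapply Rle_lt_trans; [exact H|]. apply Rmult_lt_compat_r; lra.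
Qed.

Lemma is_derive_Re_x (F : C -> C) (u : R -> R -> R) (x y : R) (l : C) :
  (forall s t, in_disc (s, t) -> u s t = Re (F (s, t))) -> in_disc (x, y) ->
  is_cderive F (x, y) l -> is_derive (fun t => u t y) x (Re l).
Proof.
  intros Hu Hxy HF.
  apply is_derive_ext_loc with (fun t => Re (F (t, y))).
  { generalize (in_disc_open_x x y Hxy). apply filter_imp. intros t Ht.
    symmetry. now apply Hu. }
  assert (H := is_derive_Re_line F (x, y) l (RtoC 1) Cmod_1 HF).
  rewrite Cmult_1_l in H.
  replace 0 with (x - x) in H by ring.
  apply (is_derive_comp _ (fun t => t - x) x _ 1) in H.
  - change (scal 1 (Re l)) with (1 * Re l) in H. rewrite Rmult_1_l in H.
    eapply is_derive_ext; [|exact H]. intros t. simpl. f_equal. f_equal.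
    apply injective_projections; simpl; ring.
  - auto_derive; [trivial|ring].
Qed.

Lemma is_derive_Re_y (F : C -> C) (u : R -> R -> R) (x y : R) (l : C) :
  (forall s t, in_disc (s, t) -> u s t = Re (F (s, t))) -> in_disc (x, y) ->
  is_cderive F (x, y) l -> is_derive (fun t => u x t) y (Re (Ci * l)%C).
Proof.
  intros Hu Hxy HF.
  apply is_derive_ext_loc with (fun t => Re (F (x, t))).
  { generalize (in_disc_open_y x y Hxy). apply filter_imp. intros t Ht.
    symmetry. now apply Hu. }
  assert (H := is_derive_Re_line F (x, y) l Ci Cmod_Ci HF).
  replace 0 with (y - y) in H by ring.
  apply (is_derive_comp _ (fun t => t - y) y _ 1) in H.
  - change (scal 1 (Re (Ci * l)%C)) with (1 * Re (Ci * l)%C) in H. rewrite Rmult_1_l in H.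
    eapply is_derive_ext; [|exact H]. intros t. simpl. f_equal. f_equal.
    apply injective_projections; simpl; ring.
  - auto_derive; [trivial|ring].
Qed.

Lemma holomorphic_n_scal (n : nat) (c : C) (F : C -> C) :
  holomorphic_n n F -> holomorphic_n n (fun z => c * F z)%C.
Proof. apply (holomorphic_n_mult n (fun _ => c)), holomorphic_n_const. Qed.

(** The partial derivatives of [Re F] are [Re F'] and [Re (i F')], again real parts of functions in
    the class. Agreement of [u] with [Re F] is asked only on the disc, since [Derive] is identified
    only there. *)
Lemma ex_diff_n_Re (n : nat) (F : C -> C) (u : R -> R -> R) :
  holomorphic_n n F -> (forall s t, in_disc (s, t) -> u s t = Re (F (s, t))) ->
  forall x y, in_disc (x, y) -> ex_diff_n u n x y.
Proof.
  revert F u. induction n as [|n IH]; intros F u HF Hu x y Hxy.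
  all: assert (HC : continuity_2d_pt u x y).
  1, 3: intros eps;
    destruct (holomorphic_n_continuous _ F HF _ Hxy eps (cond_pos eps)) as [d [Hd H]];
    destruct (in_disc_open x y Hxy) as [d' Hd'];
    exists (mkposreal (Rmin d' (d / 2)) ltac:(apply Rmin_glb_lt; [apply cond_pos|lra]));
    simpl; intros s t Hs Ht;
    apply Rmin_Rgt in Hs as [Hs1 Hs2]; apply Rmin_Rgt in Ht as [Ht1 Ht2];
    rewrite !Hu by auto;
    eapply Rle_lt_trans; [|apply (H (s, t))];
    [exact (re_le_Cmod (F (s, t) - F (x, y))%C)|];
    eapply Rle_lt_trans; [apply (Cmod_le_abs (s + - x) (t + - y))|];
    unfold Rminus in *; lra.
  - split; [exact HC|trivial].
  - destruct HF as [F1 [HF HF1]].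
    split; [exact HC|]. split; [|split; [|split]].
    + eexists. now apply is_derive_Re_x with F, HF.
    + eexists. now apply is_derive_Re_y with F, HF.
    + apply (IH F1); [assumption| |assumption]. intros s t Hst.
      apply is_derive_unique. now apply is_derive_Re_x with F, HF.
    + apply (IH (fun z => Ci * F1 z)%C); [now apply holomorphic_n_scal| |assumption].
      intros s t Hst. apply is_derive_unique. now apply is_derive_Re_y with F, HF.
Qed.

Lemma real_harmonic_Re (F : C -> C) (u : R -> R -> R) :
  holomorphic_n 2 F -> (forall s t, u s t = Re (F (s, t))) -> real_harmonic_on_disc u.
Proof.
  intros HF Hu x y Hxy. split; [now apply (ex_diff_n_Re 2 F)|].
  destruct HF as [F1 [HF [F2 [HF1 _]]]].
  unfold partial_derive. simpl.
  replace (Derive (fun t => Derive (fun s => u s y) t) x) with (Re (F2 (x, y))).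
  replace (Derive (fun t => Derive (fun s => u x s) t) y) with (Re (Ci * (Ci * F2 (x, y)))%C).
  (* The Laplacian is [Re (F'' + i (i F'')) = 0]. *)
  - destruct (F2 (x, y)). simpl. ring.
  - symmetry. apply is_derive_unique.
    apply (is_derive_Re_y (fun z => Ci * F1 z)%C (fun s t => Derive (fun w => u s w) t)); trivial.
    + intros s t Hst. apply is_derive_unique. apply is_derive_Re_y with F; auto.
    + replace (Ci * F2 (x, y))%C with (RtoC 0 * F1 (x, y) + Ci * F2 (x, y))%C by ring.
      apply is_cderive_mult; [apply is_cderive_const|now apply HF1].
  - symmetry. apply is_derive_unique.
    apply (is_derive_Re_x F1 (fun s t => Derive (fun w => u w t) s)); auto.
    intros s t Hst. apply is_derive_unique. apply is_derive_Re_x with F; auto.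
Qed.

(** Conjugation flips the imaginary part, so the two components are the real parts of
    [(1 + lambda) h] and [- i (1 - lambda) h]. *)
Lemma harmonic_on_disc_of_holomorphic (h : C -> C) (lambda : C) :
  holomorphic_n 2 h -> harmonic_on_disc (fun z => h z + Cconj (lambda * h z))%C.
Proof.
  intros Hh. split.
  - apply (real_harmonic_Re (fun z => (1 + lambda) * h z)%C).
    + now apply holomorphic_n_scal.
    + intros s t. destruct lambda, (h (s, t)). simpl. ring.
  - apply (real_harmonic_Re (fun z => (- Ci * (1 - lambda)) * h z)%C).
    + now apply holomorphic_n_scal.
    + intros s t. destruct lambda, (h (s, t)). simpl. ring.
Qed.

(** * Extremal functions *)

Lemma is_series_of_Cmod (u : nat -> C) (l : C) :
  (forall eps, 0 < eps -> exists N, forall n, (N <= n)%nat -> Cmod (Csum u n - l) < eps) ->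
  is_series (K := C_AbsRing) (V := C_NormedModule) u l.
Proof.
  intros H. apply (filterlim_locally_ball_norm (K := C_AbsRing) (U := C_NormedModule)).
  intros eps. exact (H eps (cond_pos eps)).
Qed.

Lemma is_series_Cgeom (q : C) : Cmod q < 1 ->
  is_series (K := C_AbsRing) (V := C_NormedModule) (fun k => q ^ k)%C (/ (1 - q))%C.
Proof.
  intros Hq. apply is_series_of_Cmod. intros eps He.
  assert (H1 : (1 - q)%C <> RtoC 0).
  { intros E. assert (E1 : q = RtoC 1).
    { replace q with (1 - (1 - q))%C by ring. rewrite E. ring. }
    rewrite E1, Cmod_1 in Hq. lra. }
  assert (Hc : 0 < Cmod (1 - q)) by now apply Cmod_gt_0.
  assert (HL := is_lim_seq_geom (Cmod q) ltac:(rewrite Rabs_pos_eq; [lra|apply Cmod_ge_0])).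
  destruct (proj2 (is_lim_seq_spec _ 0) HL (mkposreal (eps * Cmod (1 - q)) ltac:(nra))) as [N HN].
  exists N. intros n Hn. specialize (HN (S n) ltac:(lia)). simpl pos in HN.
  rewrite Rminus_0_r, Rabs_pos_eq in HN by apply pow_le, Cmod_ge_0.
  assert (E : ((Csum (fun k => q ^ k) n - / (1 - q)) * (1 - q))%C = (- q ^ S n)%C).
  { assert (HT : forall T : C, (T * (1 - q) = 1 - q ^ S n ->
      (T - / (1 - q)) * (1 - q) = - q ^ S n)%C).
    { intros T HT. transitivity (T * (1 - q) - 1)%C; [field; exact H1|]. rewrite HT. ring. }
    apply HT, Csum_geom. }
  apply (f_equal Cmod) in E. rewrite Cmod_mult, Cmod_opp, Cmod_pow in E.
  apply Rmult_lt_reg_r with (1 := Hc). rewrite E. exact HN.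
Qed.

(** The index [(n - m) / p] recovers [k] from [n = p k + m]. *)
Lemma harmonic_class_of_coefficients (p m : nat) (h : C -> C) (alpha : nat -> C) (lambda : C) :
  (1 <= p)%nat -> holomorphic_n 2 h ->
  (forall z, in_disc z -> is_series (K := C_AbsRing) (V := C_NormedModule)
     (fun k => alpha k * z ^ (p * k + m))%C (h z)) ->
  bounded_on_disc h -> Cmod lambda = 1 ->
  harmonic_class p m (fun z => h z + Cconj (lambda * h z))%C h (fun z => lambda * h z)%C
    (fun n => alpha ((n - m) / p)%nat) (fun n => lambda * alpha ((n - m) / p)%nat)%C.
Proof.
  intros Hp Hh Hs Hb Hl.
  assert (Hi : forall k, ((p * k + m - m) / p)%nat = k).
  { intros k. rewrite Nat.add_sub, Nat.mul_comm. apply Nat.div_mul. lia. }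
  constructor.
  - now apply harmonic_on_disc_of_holomorphic.
  - reflexivity.
  - destruct Hh as [F1 [HF _]]. intros z Hz. exists (F1 z). now apply HF.
  - destruct (holomorphic_n_scal 2 lambda h Hh) as [F1 [HF _]].
    intros z Hz. exists (F1 z). now apply HF.
  - intros z Hz. eapply is_series_ext; [|now apply Hs].
    intros k. simpl. now rewrite Hi.
  - intros z Hz.
    eapply is_series_ext;
      [|apply (is_series_scal (K := C_AbsRing) (V := C_NormedModule) lambda), Hs, Hz].
    intros k. simpl. rewrite Hi. change (@scal C_AbsRing C_NormedModule) with Cmult. Cring.
  - exact Hb.
  - destruct Hb as [M HM]. exists M. intros z Hz. rewrite Cmod_mult, Hl, Rmult_1_l. auto.
Qed.

(** Both parts have norm [1] and equal coefficient moduli, so [B_H] is twice one series and equals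
    [1] at [R0]. Beyond [R0] the term [k = 0] increases strictly, as [alpha 0 <> 0] and [m >= 1],
    and the others do not decrease. *)
Lemma extremal_of_coefficients (p m : nat) (R0 : R) (h : C -> C) (alpha : nat -> C) (lambda : C) :
  (1 <= p)%nat -> (1 <= m)%nat -> 0 < R0 -> holomorphic_n 2 h ->
  (forall z, in_disc z -> is_series (K := C_AbsRing) (V := C_NormedModule)
     (fun k => alpha k * z ^ (p * k + m))%C (h z)) ->
  bounded_on_disc h -> sup_norm h = 1 -> alpha 0%nat <> RtoC 0 ->
  Series (fun k => Cmod (alpha k) * R0 ^ (p * k + m)) = 1 / 2 ->
  Cmod lambda = 1 ->
  extremal p m R0 (fun z => h z + Cconj (lambda * h z))%C h (fun z => lambda * h z)%C.
Proof.
  intros Hp Hm HR0 Hh Hs Hb Hsup H0 HE Hl.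
  assert (Hi : forall k, ((p * k + m - m) / p)%nat = k).
  { intros k. rewrite Nat.add_sub, Nat.mul_comm. apply Nat.div_mul. lia. }
  exists (fun n => alpha ((n - m) / p)%nat), (fun n => lambda * alpha ((n - m) / p)%nat)%C.
  assert (HC := harmonic_class_of_coefficients p m h alpha lambda Hp Hh Hs Hb Hl).
  split; [exact HC|].
  assert (HN : max_norm h (fun z => lambda * h z)%C = 1).
  { assert (E : sup_norm (fun z => lambda * h z)%C = sup_norm h).
    { unfold sup_norm. f_equal. apply Lub_Rbar_eqset. intros x.
      split; intros [z [Hz ->]]; exists z; (split; [assumption|]);
      rewrite Cmod_mult, Hl; lra. }
    unfold max_norm. rewrite E, Hsup. apply Rmax_left. lra. }
  assert (HB : forall r, B_H p m (fun n => alpha ((n - m) / p)%nat)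
      (fun n => lambda * alpha ((n - m) / p)%nat)%C r
    = 2 * Series (fun k => Cmod (alpha k) * r ^ (p * k + m))).
  { intros r. unfold B_H. rewrite <- Series_scal_l. apply Series_ext. intros k.
    rewrite Hi, Cmod_mult, Hl. ring. }
  assert (Hex : forall r, 0 <= r < 1 -> ex_series (fun k => Cmod (alpha k) * r ^ (p * k + m))).
  { intros r Hr.
    eapply ex_series_ext; [|apply (lacunary_abs_summable p m _ h r Hp (hc_expansion_h _ _ _ _ _ _ _ HC) Hr)].
    intros k. cbv beta. now rewrite Hi. }
  rewrite HN. split; [rewrite HB, HE; field|].
  intros r Hr. rewrite HB.
  assert (HR1 : R0 < 1) by lra.
  rewrite Series_incr_1 by (apply Hex; lra). rewrite Series_incr_1 in HE by (apply Hex; lra).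
  assert (HT : Series (fun k => Cmod (alpha (S k)) * R0 ^ (p * S k + m))
    <= Series (fun k => Cmod (alpha (S k)) * r ^ (p * S k + m))).
  { apply Series_le.
    - intros k. split.
      + apply Rmult_le_pos; [apply Cmod_ge_0|apply pow_le; lra].
      + apply Rmult_le_compat_l; [apply Cmod_ge_0|apply pow_incr; lra].
    - apply (ex_series_incr_1 (fun k => Cmod (alpha k) * r ^ (p * k + m))). apply Hex. lra. }
  assert (Hlt : R0 ^ (p * 0 + m) < r ^ (p * 0 + m)) by (apply pow_lt_compat; [lra|lia]).
  assert (Cmod (alpha 0%nat) * R0 ^ (p * 0 + m) < Cmod (alpha 0%nat) * r ^ (p * 0 + m)).
  { apply Rmult_lt_compat_l; [now apply Cmod_gt_0|exact Hlt]. }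
  lra.
Qed.

Lemma is_series_zero_tail {K : AbsRing} {V : NormedModule K} (u : nat -> V) :
  (forall k, u (S k) = zero) -> is_series u (u 0%nat).
Proof.
  intros Hu. apply (filterlim_ext (fun _ => u 0%nat)); [|apply filterlim_const].
  intros n. rewrite <- (sum_O u). symmetry. apply (sum_n_trunc _ u 0 n).
  intros [|k] Hk; [lia|apply Hu].
Qed.

Definition monomial_coeff (k : nat) : C := match k with O => RtoC 1 | S _ => RtoC 0 end.

Lemma monomial_extremal (p m : nat) (R0 : R) (lambda : C) :
  (1 <= p)%nat -> (1 <= m)%nat -> 0 < R0 -> R0 ^ m = 1 / 2 -> Cmod lambda = 1 ->
  extremal p m R0 (fun z => z ^ m + Cconj (lambda * z ^ m))%C
    (fun z => z ^ m)%C (fun z => lambda * z ^ m)%C.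
Proof.
  intros Hp Hm HR0 HE Hl.
  assert (Hb : forall z, in_disc z -> Cmod (z ^ m)%C <= 1).
  { intros z Hz. unfold in_disc in Hz. rewrite Cmod_pow, <- (pow1 m).
    apply pow_incr. generalize (Cmod_ge_0 z). lra. }
  apply (extremal_of_coefficients p m R0 (fun z => z ^ m)%C monomial_coeff); trivial.
  - apply holomorphic_n_pow.
  - intros z Hz.
    replace (z ^ m)%C with (monomial_coeff 0 * z ^ (p * 0 + m))%C.
    + apply (is_series_zero_tail (V := C_NormedModule)
        (fun k => monomial_coeff k * z ^ (p * k + m))%C).
      intros k. apply Cmult_0_l.
    + simpl. rewrite Nat.mul_0_r. simpl. ring.
  - now exists 1.
  - apply sup_norm_eq_1; [assumption|]. exists m. intros s Hs.
    exists (RtoC s). split.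
    + unfold in_disc. rewrite Cmod_R, Rabs_pos_eq; lra.
    + rewrite Cmod_pow, Cmod_R, Rabs_pos_eq; lra.
  - simpl. intros E. injection E. lra.
  - apply is_series_unique.
    replace (1 / 2) with (Cmod (monomial_coeff 0) * R0 ^ (p * 0 + m)).
    + apply (is_series_zero_tail (V := R_NormedModule)
        (fun k => Cmod (monomial_coeff k) * R0 ^ (p * k + m))).
      intros k. simpl. rewrite Cmod_0. apply Rmult_0_l.
    + simpl. rewrite Nat.mul_0_r, Cmod_1, Rmult_1_l. exact HE.
Qed.

(** * The Moebius extremal function *)

Definition moebius_coeff (a : R) (k : nat) : C :=
  match k with O => RtoC (- a) | S j => RtoC ((1 - a ^ 2) * a ^ j) end.

Lemma moebius_denominator (a : R) (w : C) : 0 <= a <= 1 -> Cmod w < 1 ->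
  (1 - RtoC a * w)%C <> RtoC 0.
Proof.
  intros Ha Hw E.
  assert (E1 : (RtoC a * w)%C = RtoC 1).
  { replace (RtoC a * w)%C with (1 - (1 - RtoC a * w))%C by ring. rewrite E. ring. }
  apply (f_equal Cmod) in E1. rewrite Cmod_mult, Cmod_R, Cmod_1, Rabs_pos_eq in E1 by tauto.
  generalize (Cmod_ge_0 w). nra.
Qed.

Lemma Cmod_pow_lt_1 (z : C) (p : nat) : (1 <= p)%nat -> in_disc z -> Cmod (z ^ p)%C < 1.
Proof.
  intros Hp Hz. rewrite Cmod_pow. apply pow_lt_1_compat; [|lia].
  split; [apply Cmod_ge_0|exact Hz].
Qed.

Lemma Cmod_extremal_h_le (p m : nat) (a : R) (z : C) : (1 <= p)%nat -> 0 <= a <= 1 ->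
  in_disc z -> Cmod (extremal_h p m a z) <= 1.
Proof.
  intros Hp Ha Hz. unfold extremal_h.
  assert (Hw := Cmod_pow_lt_1 z p Hp Hz). set (w := (z ^ p)%C) in *.
  assert (Hd := moebius_denominator a w Ha Hw).
  assert (H1 : Cmod (z ^ m)%C <= 1).
  { unfold in_disc in Hz. rewrite Cmod_pow, <- (pow1 m).
    apply pow_incr. generalize (Cmod_ge_0 z). lra. }
  assert (Hd' : 0 < Cmod (1 - RtoC a * w)) by now apply Cmod_gt_0.
  assert (H2 : Cmod (w - RtoC a) <= Cmod (1 - RtoC a * w)).
  { assert (Hw2 : Cmod w ^ 2 < 1) by (generalize (Cmod_ge_0 w); nra).
    apply pow_le_inv with 2%nat; [apply Cmod_ge_0|lra|lia|].
    rewrite !Cmod2_alt. rewrite Cmod2_alt in Hw2. destruct w as [x y]. simpl in *.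
    (* This product is [|1 - a w|^2 - |w - a|^2]. *)
    assert (0 <= (1 - a ^ 2) * (1 - (x ^ 2 + y ^ 2))) by (apply Rmult_le_pos; nra).
    nra. }
  rewrite Cmod_mult, Cmod_div by assumption.
  assert (Cmod (w - RtoC a) / Cmod (1 - RtoC a * w) <= 1).
  { apply Rmult_le_reg_r with (1 := Hd'). unfold Rdiv. rewrite Rmult_assoc, Rinv_l; lra. }
  assert (0 <= Cmod (w - RtoC a) / Cmod (1 - RtoC a * w))
    by (apply Rdiv_le_0_compat; [apply Cmod_ge_0|assumption]).
  generalize (Cmod_ge_0 (z ^ m)%C). nra.
Qed.

(* At [z = s cis (PI / p)] one has [z ^ p = - s ^ p], where the Moebius factor has
   modulus [(s ^ p + a) / (1 + a s ^ p) >= s ^ p] for every [a] in [[0, 1]], even [a = 1]. *)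
Lemma sup_norm_extremal_h (p m : nat) (a : R) : (1 <= p)%nat -> 0 <= a <= 1 ->
  sup_norm (extremal_h p m a) = 1.
Proof.
  intros Hp Ha. apply sup_norm_eq_1; [intros; now apply Cmod_extremal_h_le|].
  exists (m + p)%nat. intros s Hs.
  exists (s * cis (PI / INR p))%C. split; [apply in_disc_polar; lra|].
  assert (HpR : 0 < INR p) by (apply lt_0_INR; lia).
  unfold extremal_h. rewrite Cmod_mult, Cmod_pow, Cmod_mult, Cmod_cis, Cmod_R.
  rewrite (Rabs_pos_eq s), Rmult_1_r by lra.
  assert (E : ((s * cis (PI / INR p)) ^ p)%C = RtoC (- s ^ p)).
  { rewrite Cpow_mult_l, cis_pow, <- RtoC_pow.
    replace (INR p * (PI / INR p)) with PI by (field; lra).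
    unfold cis. rewrite cos_PI, sin_PI. apply injective_projections; simpl; ring. }
  rewrite E, pow_add. apply Rmult_le_compat_l; [apply pow_le; lra|].
  assert (Hw : 0 < s ^ p) by (apply pow_lt; lra).
  assert (Hw1 : s ^ p < 1) by (apply pow_lt_1_compat; [lra|lia]).
  rewrite <- RtoC_minus, <- RtoC_mult, <- RtoC_minus.
  assert (0 <= a * s ^ p) by (apply Rmult_le_pos; lra).
  rewrite <- RtoC_div, Cmod_R by lra.
  unfold Rdiv. rewrite Rabs_mult, Rabs_inv, Rabs_left, (Rabs_pos_eq (1 - _)) by lra.
  apply Rmult_le_reg_r with (1 - a * - s ^ p); [lra|].
  rewrite Rmult_assoc, Rinv_l by lra. nra.
Qed.

Lemma holomorphic_extremal_h (n p m : nat) (a : R) : (1 <= p)%nat -> 0 <= a <= 1 ->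
  holomorphic_n n (extremal_h p m a).
Proof.
  intros Hp Ha. unfold extremal_h, Cdiv.
  apply (holomorphic_n_mult n (fun z => z ^ m)%C); [apply holomorphic_n_pow|].
  apply (holomorphic_n_mult n (fun z => z ^ p - RtoC a)%C (fun z => / (1 - RtoC a * z ^ p))%C).
  - apply (holomorphic_n_plus n (fun z => z ^ p)%C (fun _ => - RtoC a)%C).
    + apply holomorphic_n_pow.
    + apply holomorphic_n_const.
  - apply (holomorphic_n_inv n (fun z => 1 - RtoC a * z ^ p)%C).
    + replace (fun z : C => (1 - RtoC a * z ^ p)%C) with (fun z : C => (1 + (- RtoC a) * z ^ p)%C)
        by (apply functional_extensionality; intros; ring).
      apply (holomorphic_n_plus (S n) (fun _ => RtoC 1)); [apply holomorphic_n_const|].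
      apply holomorphic_n_scal, holomorphic_n_pow.
    + intros z Hz. apply moebius_denominator; [assumption|]. now apply Cmod_pow_lt_1.
Qed.

(** From [(w - a) / (1 - a w) = - a + (1 - a^2) w / (1 - a w)]: after removal of the first term the
    series is geometric. *)
Lemma extremal_h_expansion (p m : nat) (a : R) (z : C) : (1 <= p)%nat -> 0 <= a <= 1 ->
  in_disc z -> is_series (K := C_AbsRing) (V := C_NormedModule)
    (fun k => moebius_coeff a k * z ^ (p * k + m))%C (extremal_h p m a z).
Proof.
  intros Hp Ha Hz.
  assert (Hw := Cmod_pow_lt_1 z p Hp Hz).
  assert (Hd := moebius_denominator a (z ^ p)%C Ha Hw).
  apply (is_series_decr_1 (K := C_AbsRing) (V := C_NormedModule)).
  assert (Hq : Cmod (RtoC a * z ^ p)%C < 1).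
  { rewrite Cmod_mult, Cmod_R, Rabs_pos_eq by tauto. generalize (Cmod_ge_0 (z ^ p)%C). nra. }
  generalize (is_series_scal (K := C_AbsRing) (V := C_NormedModule)
    (RtoC (1 - a ^ 2) * z ^ p * z ^ m)%C _ _ (is_series_Cgeom _ Hq)).
  change (@scal C_AbsRing C_NormedModule) with Cmult.
  intros H.
  match type of H with is_series _ ?l =>
    match goal with |- is_series _ ?l' => replace l' with l end end.
  - eapply is_series_ext; [|exact H]. intros k. cbv beta.
    change (moebius_coeff a (S k)) with (RtoC ((1 - a ^ 2) * a ^ k)). rewrite Cpow_mult_l, <- Cpow_mult_r.
    replace (p * S k + m)%nat with (p * k + p + m)%nat by lia.
    rewrite !Cpow_add_r, RtoC_mult, RtoC_pow. Cring.
  - change (@plus C_NormedModule) with Cplus. change (@opp C_NormedModule) with Copp.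
    unfold extremal_h. change (moebius_coeff a 0) with (RtoC (- a)). rewrite Nat.mul_0_r, Nat.add_0_l.
    rewrite RtoC_minus, RtoC_pow, RtoC_opp. field. exact Hd.
Qed.

Lemma moebius_coeff_series (p m : nat) (a r : R) : (1 <= p)%nat -> 0 <= a <= 1 -> 0 <= r < 1 ->
  Series (fun k => Cmod (moebius_coeff a k) * r ^ (p * k + m)) = r ^ m * moebius_bohr a (r ^ p).
Proof.
  intros Hp Ha Hr. apply is_series_unique.
  assert (Hrho : 0 <= r ^ p < 1) by (apply pow_lt_1_compat; [lra|lia]).
  apply (is_series_decr_1 (K := R_AbsRing) (V := R_NormedModule)).
  assert (Hq : Rabs (a * r ^ p) < 1) by (rewrite Rabs_pos_eq; nra).
  generalize (is_series_scal_l ((1 - a ^ 2) * r ^ p * r ^ m) _ _ (is_series_geom _ Hq)).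
  change (@scal R_AbsRing R_NormedModule) with Rmult.
  intros H.
  match type of H with is_series _ ?l =>
    match goal with |- is_series _ ?l' => replace l' with l end end.
  - eapply is_series_ext; [|exact H]. intros k. cbv beta.
    change (moebius_coeff a (S k)) with (RtoC ((1 - a ^ 2) * a ^ k)).
    rewrite Cmod_R, Rabs_pos_eq.
    + rewrite Rpow_mult_distr, <- pow_mult.
      replace (p * S k + m)%nat with (p * k + p + m)%nat by lia.
      rewrite !pow_add. Rring.
    + apply Rmult_le_pos; [nra|apply pow_le; lra].
  - change (@plus R_NormedModule) with Rplus. change (@opp R_NormedModule) with Ropp.
    change (moebius_coeff a 0) with (RtoC (- a)). rewrite Cmod_R, Rabs_Ropp, Rabs_pos_eq by tauto.
    rewrite Nat.mul_0_r, Nat.add_0_l. unfold moebius_bohr.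
    assert (a * r ^ p < 1) by nra. simpl. field. lra.
Qed.

Lemma moebius_extremal (p m : nat) (r : R) (lambda : C) :
  (1 <= m <= p)%nat -> 0 < r < 1 -> radius_poly p m r = 0 -> 1 / 3 <= r ^ p ->
  Cmod lambda = 1 ->
  let h := extremal_h p m (extremal_parameter p r) in
  extremal p m r (fun z => h z + Cconj (lambda * h z))%C h (fun z => lambda * h z)%C.
Proof.
  intros Hmp Hr HF H3 Hl h.
  destruct (extremal_parameter_spec p m r) as [Ha HE]; try assumption; try lia.
  set (a := extremal_parameter p r) in *.
  assert (Hp : (1 <= p)%nat) by lia.
  apply (extremal_of_coefficients p m r h (moebius_coeff a)); trivial; try lia; try lra.
  - apply holomorphic_extremal_h; [assumption|lra].
  - intros z Hz. apply extremal_h_expansion; trivial; lra.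
  - exists 1. intros z Hz. apply Cmod_extremal_h_le; trivial; lra.
  - apply sup_norm_extremal_h; [assumption|lra].
  - simpl. intros E. injection E. lra.
  - rewrite moebius_coeff_series by (trivial; lra). exact HE.
Qed.

Theorem theorem2 :
  forall m p : nat, (1 <= m)%nat -> (2 <= p)%nat ->
  (INR p / INR m > log2 3 ->
     let R0 := Rpower (1 / 2) (1 / INR m) in
     bohr_inequality_up_to p m R0 /\
     forall lambda : C, Cmod lambda = 1 ->
       extremal p m R0
         (fun z => (z ^ m + Cconj (lambda * z ^ m))%C)
         (fun z => (z ^ m)%C)
         (fun z => (lambda * z ^ m)%C)) /\
  (1 <= INR p / INR m <= log2 3 ->
     exists r_pm : R, is_maximal_root p m r_pm /\
     bohr_inequality_up_to p m r_pm /\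
     forall lambda : C, Cmod lambda = 1 ->
       let h := extremal_h p m (extremal_parameter p r_pm) in
       extremal p m r_pm
         (fun z => (h z + Cconj (lambda * h z))%C)
         h
         (fun z => (lambda * h z)%C)).
Proof.
  intros m p Hm Hp. split.
  - intros H R0. split; [apply bohr_inequality_large_p; trivial; lia|].
    intros lambda Hl. apply monomial_extremal; trivial; try lia.
    + apply exp_pos.
    + apply Rpower_inv_INR; [lra|assumption].
  - intros [H1 H2].
    assert (Hmp : (1 <= m <= p)%nat) by (split; [assumption|now apply div_ge_1]).
    destruct (radius_root_exists m p Hmp H2) as [r [Hr [HF H3]]].
    (* The witness comes from the intermediate value theorem or is its left endpoint; its maximality
       follows from positivity of the polynomial to its right. *)
    exists r. split; [|split].
    + split; [split; [assumption|exact HF]|].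
      intros s Hs HFs. apply Rnot_lt_le. intros Hrs.
      assert (HP := radius_root_is_maximal p m r s Hmp Hr HF H3 ltac:(lra)).
      unfold radius_equation in HFs. unfold radius_poly in HP. lra.
    + now apply bohr_inequality_small_p.
    + intros lambda Hl. now apply moebius_extremal.
Qed.
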